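(* Let $d\ge1$ and let $f\colon[0,\infty)\to\mathbb{R}$ be an admissible kernel profile in dimension $d$, with associated multiscale kernel $K$. Suppose that $f$ is differentiable and that there exists $A_1>0$ such that $r^{3/2}|f'(r)|\le A_1$ for all $r\ge 0$. Let $\sigma>0$, let $\alpha\in\mathcal{P}_3(\mathbb{R}^d)$, let $y_i$, $i\in\mathbb{N}$, be i.i.d. random variables with distribution $\alpha$, and let $\alpha_n=\frac1n\sum_{i=1}^n\delta_{y_i}$. Then there is a constant $b>0$, depending only on $d$, such that for all $n\ge1$ $$\mathbb{E}\left[\sup_{x\in\mathbb{R}^d}\left\|\Sigma_{\alpha_n}(x,\sigma)-\Sigma_\alpha(x,\sigma)\right\|\right]\le\frac{\sigma A_f\,b}{C_d(\sigma)}\,m_3(\alpha)\cdot\begin{cases}n^{-2/3}+n^{-1/2}&\text{if }d=1,\\ n^{-2/3}+n^{-1/2}\log(1+n)&\text{if }d=2,\\ n^{-2/3}+n^{-1/d}&\text{if }d\ge3.\end{cases}$$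
   Context: An admissible kernel profile in dimension $d$ is a bounded measurable function $f\colon[0,\infty)\to\mathbb{R}$ such that (a) $f(r)\ge 0$ for all $r$; (b) $M_d=\int_0^\infty r^{\frac d2-1}f(r)\,dr<\infty$; (c) there is $C>0$ with $rf(r)\le C$ for all $r\ge0$; normalized so that $\sup f=1$. The associated multiscale kernel is $K(x,y,\sigma)=\frac{1}{C_d(\sigma)}f\!\left(\frac{\|y-x\|^2}{\sigma^2}\right)$, where $C_d(\sigma)=\frac12\sigma^dM_d\,\omega_{d-1}$ and $\omega_{d-1}=2\pi^{d/2}/\Gamma(d/2)$. For a Borel probability measure $\alpha$ on $\mathbb{R}^d$, $\Sigma_\alpha(x,\sigma)=\int_{\mathbb{R}^d}(y-x)\otimes(y-x)K(x,y,\sigma)\,\alpha(dy)\in\mathbb{R}^d\otimes\mathbb{R}^d$; identifying $x\otimes y$ with $xy^T$, $\|\cdot\|$ is the Frobenius norm. For $p\ge1$, $\mathcal{P}_p(\mathbb{R}^d)$ is the set of Borel probability measures with finite $p$-th moment and $m_p(\alpha)=\left(\int\|z\|^p\alpha(dz)\right)^{1/p}$. $A_f>0$ denotes a constant depending only on $f$ such that $\sup_{x}\|\Sigma_\alpha(x,\sigma)-\Sigma_\beta(x,\sigma)\|\le\frac{\sigma A_f}{C_d(\sigma)}W_1(\alpha,\beta)$ for all $\alpha,\beta\in\mathcal{P}_1(\mathbb{R}^d)$ and $\sigma>0$ (such a constant exists under the stated hypotheses on $f$), where $W_1$ is the 1-Wasserstein distance. *)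

(* Defs.v *)
From HB Require Import structures.
From mathcomp Require Import all_boot all_order all_algebra finmap.
From mathcomp Require Import all_classical all_reals all_analysis.

Set Implicit Arguments.
Unset Strict Implicit.
Unset Printing Implicit Defensive.
Import Order.TTheory GRing.Theory Num.Theory.
Import numFieldNormedType.Exports.

Local Open Scope classical_set_scope.
Local Open Scope ring_scope.

(* For row vectors this is the Euclidean norm; the norm `|_| that the library
   puts on matrices is the sup norm. *)
Definition frobenius (R : realType) (m n : nat) (A : 'M[R]_(m, n)) : R :=
  Num.sqrt (\sum_(i < m) \sum_(j < n) A i j ^+ 2).

(* Vectors are rows, so the matrix usually written x y^T for columns is
   x^T *m y here; its (i, j) entry is x_i y_j. *)
Definition outer (R : realType) (d : nat) (x y : 'rV[R]_d) : 'M[R]_d :=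
  x^T *m y.

(* R^d with its Borel sets; the carrier is convertible to 'rV[R]_d, whose
   topology is the usual one. *)
Definition borel_space (R : realType) (d : nat) : measurableType _ :=
  g_sigma_algebraType (@open 'rV[R]_d).

Definition Gamma (R : realType) (s : R) : R :=
  \int[@lebesgue_measure R]_(t in `]0, +oo[) (t `^ (s - 1) * expR (- t)).

(* omega_{d-1} *)
Definition sphere_area (R : realType) (d : nat) : R :=
  2 * pi `^ (d%:R / 2) / Gamma (d%:R / 2).

(* Functions on [0, +oo[ are represented by functions on R whose values at
   negative reals play no role. *)
Definition kernel_mass (R : realType) (d : nat) (f : R -> R) : \bar R :=
  (\int[@lebesgue_measure R]_(r in `]0%R, +oo[)
     (r `^ (d%:R / 2 - 1) * f r)%:E)%E.

Record admissible_profile (R : realType) (d : nat) (f : R -> R) : Prop := {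
  profile_measurable : measurable_fun `[(0 : R), +oo[ f;
  profile_bounded : exists B : R, forall r : R, 0 <= r -> `|f r| <= B;
  profile_ge0 : forall r : R, 0 <= r -> 0 <= f r;
  profile_mass : (kernel_mass d f < +oo)%E;
  profile_decay : exists C : R, 0 < C /\ forall r : R, 0 <= r -> r * f r <= C;
  profile_sup : sup (f @` `[0, +oo[) = 1
}.

(* Differentiability on [0, +oo[, one-sided at 0. *)
Definition derivable_halfline (R : realType) (f : R -> R) : Prop :=
  (forall r : R, 0 < r -> derivable f r 1) /\
  cvg ((fun h => h^-1 * (f h - f 0)) @ 0^'+).

Definition normalizer (R : realType) (d : nat) (f : R -> R) (sigma : R) : R :=
  2^-1 * sigma ^+ d * fine (kernel_mass d f) * sphere_area R d.

Definition multiscale_kernel (R : realType) (d : nat) (f : R -> R)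
    (x y : 'rV[R]_d) (sigma : R) : R :=
  (normalizer d f sigma)^-1 * f (frobenius (y - x) ^+ 2 / sigma ^+ 2).

Definition Sigma (R : realType) (d : nat) (f : R -> R)
    (alpha : {measure set (borel_space R d) -> \bar R}) (x : 'rV[R]_d) (sigma : R) :
    'M[R]_d :=
  \matrix_(i, j) \int[alpha]_(y in setT)
    (outer (y - x : 'rV[R]_d) (y - x) i j * multiscale_kernel f x y sigma).

(* sup_x || Sigma_alpha(x, sigma) - Sigma_beta(x, sigma) || *)
Definition Sigma_sup_dist (R : realType) (d : nat) (f : R -> R)
    (alpha beta : {measure set (borel_space R d) -> \bar R}) (sigma : R) : \bar R :=
  ereal_sup [set (frobenius (Sigma f alpha x sigma - Sigma f beta x sigma))%:E
            | x in [set: 'rV[R]_d]].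

Definition moment_integral (R : realType) (d : nat) (p : R)
    (alpha : {measure set (borel_space R d) -> \bar R}) : \bar R :=
  (\int[alpha]_z (frobenius (z : 'rV[R]_d) `^ p)%:E)%E.

Definition finite_moment (R : realType) (d : nat) (p : R)
    (alpha : {measure set (borel_space R d) -> \bar R}) : Prop :=
  (moment_integral p alpha < +oo)%E.

Definition moment (R : realType) (d : nat) (p : R)
    (alpha : {measure set (borel_space R d) -> \bar R}) : R :=
  fine (moment_integral p alpha) `^ p^-1.

(* The product sigma-algebra is the Borel sigma-algebra of R^d x R^d. *)
Definition coupling (R : realType) (d : nat)
    (alpha beta : probability (borel_space R d) R)
    (gamma : probability (borel_space R d * borel_space R d)%type R) : Prop :=
  (forall A : set (borel_space R d), measurable A -> gamma (A `*` setT) = alpha A) /\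
  (forall B : set (borel_space R d), measurable B -> gamma (setT `*` B) = beta B).

Definition W1 (R : realType) (d : nat)
    (alpha beta : probability (borel_space R d) R) : \bar R :=
  ereal_inf [set (\int[gamma]_z (frobenius (z.1 - z.2 : 'rV[R]_d))%:E)%E
            | gamma in [set gamma | coupling alpha beta gamma]].

Definition W1_stability_constant (R : realType) (d : nat) (f : R -> R)
    (A_f : R) : Prop :=
  forall (alpha beta : probability (borel_space R d) R) (sigma : R),
    finite_moment 1 alpha -> finite_moment 1 beta -> 0 < sigma ->
    (Sigma_sup_dist f alpha beta sigma
       <= (sigma * A_f / normalizer d f sigma)%:E * W1 alpha beta)%E.

Definition mutually_independent (R : realType) (d : nat)
    (disp : measure_display) (Omega : measurableType disp)
    (P : probability Omega R) (y : nat -> {RV P >-> borel_space R d}) : Prop :=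
  forall (J : {fset nat}) (A : nat -> set (borel_space R d)),
    (forall i, measurable (A i)) ->
    P (\bigcap_(i in [set` J]) (y i @^-1` A i)) =
      (\prod_(i <- J) P (y i @^-1` A i))%E.

Definition iid_with_law (R : realType) (d : nat)
    (disp : measure_display) (Omega : measurableType disp)
    (P : probability Omega R) (y : nat -> {RV P >-> borel_space R d})
    (alpha : probability (borel_space R d) R) : Prop :=
  mutually_independent y /\
  forall (i : nat) (A : set (borel_space R d)),
    measurable A -> distribution P (y i) A = alpha A.

Definition empirical_measure (R : realType) (d : nat)
    (y : nat -> borel_space R d) (n : nat) : {measure set (borel_space R d) -> \bar R} :=
  mscale (n%:R^-1)%:nng (msum (fun i => dirac (y i)) n).

Definition rate (R : realType) (d n : nat) : R :=
  match d with
  | 1 => n%:R `^ (- (2 / 3)) + n%:R `^ (- 2^-1)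
  | 2 => n%:R `^ (- (2 / 3)) + n%:R `^ (- 2^-1) * ln (1 + n%:R)
  | _ => n%:R `^ (- (2 / 3)) + n%:R `^ (- d%:R^-1)
  end.

(* Main.v *)
Require Import Defs.
From HB Require Import structures.
From mathcomp Require Import all_boot all_order all_algebra finmap.
From mathcomp Require Import all_classical all_reals all_analysis.
From mathcomp Require Import measurable_realfun.
From mathcomp Require Import ring lra.
Set Implicit Arguments.
Unset Strict Implicit.
Unset Printing Implicit Defensive.
Import Order.TTheory GRing.Theory Num.Theory.
Import numFieldNormedType.Exports.
Local Open Scope classical_set_scope.
Local Open Scope ring_scope.

(* By the stability constant it suffices to bound E W1(alpha_n, alpha), as in
   Fournier and Guillin. Fix a scale s >= m_3(alpha), cut R^d into the ball of
   radius s, the shells 2^(m-1) s < |x| <= 2^m s for 1 <= m <= L and an outer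
   region, and subdivide each shell dyadically, L times, into cubes. Matching the
   two measures greedily from the smallest cubes to the whole space gives a
   coupling whose cost is at most the size of the smallest cubes, plus the first
   moments of the outer region, plus the sum over all cubes Q of
   diam(Q) |alpha_n(Q) - alpha(Q)|. The expectation of the last factor is
   controlled by the variance of alpha_n(Q), at most alpha(Q) / n. Since alpha(shell m) <= 8 / 8^m, the
   sum over the shells converges geometrically, so that with i the depth of
   subdivision E W1 is at most a constant times
   s (2^(-L) + n^(-1/2) sum_(i <= L) 2^(i (d/2 - 1))),
   and one takes 2^(d L) of order n. Finally s tends to m_3(alpha), which also
   covers m_3(alpha) = 0. *)

(** * Transport on a finite tree *)

(** Two obstacles shape the proof. Neither the supremum over x nor [W1] is shown to be measurable in
    the sample, so the integral on the left is only compared, through [ge0_le_integral_nomeas], with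
    that of an explicit measurable majorant, a finite sum over cells. And a coupling must be a
    probability on the product space: with finitely many cells it suffices to find a matrix p k l
    with the right row and column sums and to spread the mass p k l over cell k times cell l by a
    multiple of the product measure, so no disintegration and no limit of plans occurs. The square
    root of the variance is avoided by |X| <= X^2 / (2 tau) + tau / 2, with one tau for each level
    and shell, chosen so that the sum over blocks is what Cauchy-Schwarz would give: of order 2^(d i
    / 2) sqrt(alpha(shell m) / n), hence 2^(d i / 2) 2^(-3 m / 2) n^(-1/2). Moving inside such
    blocks costs 2^m s 2^(-i). The product carries the factor 2^(-m / 2), which is how the third
    moment makes the shells summable. *)

Section tree_transport.
Context (R : realFieldType) (K B : finType).
Implicit Types (r s a b : K -> R) (q : K -> B) (D : K -> K -> R).

Definition block_sum q r (c : B) : R := \sum_(k | q k == c) r k.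

Lemma block_sum_ge0 q r c : (forall k, 0 <= r k) -> 0 <= block_sum q r c.
Proof. by move=> r0; apply: sumr_ge0 => k _; exact: r0. Qed.

Lemma le_block_sum q r k : (forall k, 0 <= r k) -> r k <= block_sum q r (q k).
Proof.
move=> r0; rewrite /block_sum (bigD1 k)//= lerDl.
by apply: sumr_ge0 => l _; exact: r0.
Qed.

Lemma sum_block_sumM q r (H : B -> R) :
  \sum_k H (q k) * r k = \sum_c H c * block_sum q r c.
Proof.
rewrite (partition_big q xpredT)//=; apply: eq_bigr => c _.
by rewrite /block_sum mulr_sumr; apply: eq_bigr => k /eqP ->.
Qed.

(* Inside each block the smaller of the two masses is entirely transported,
   by a multiple of the product plan (where both masses vanish, 0 / 0 = 0). *)
Definition block_plan q r s (k l : K) : R :=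
  if q k == q l then
    r k * s l / Num.max (block_sum q r (q k)) (block_sum q s (q k))
  else 0.

Section block_plan_theory.
Context q r s (r0 : forall k, 0 <= r k) (s0 : forall k, 0 <= s k).

Let max0 c : 0 <= Num.max (block_sum q r c) (block_sum q s c).
Proof. by rewrite le_max block_sum_ge0. Qed.

Lemma block_plan_ge0 k l : 0 <= block_plan q r s k l.
Proof.
rewrite /block_plan; case: ifP => // _.
by rewrite divr_ge0// mulr_ge0.
Qed.

Lemma block_plan_out k l : q k != q l -> block_plan q r s k l = 0.
Proof. by rewrite /block_plan => /negbTE ->. Qed.

Lemma block_plan_suml k : \sum_l block_plan q r s k l =
  r k * block_sum q s (q k) / Num.max (block_sum q r (q k)) (block_sum q s (q k)).
Proof.
rewrite /block_plan -big_mkcond/= /block_sum -mulrA mulr_suml mulr_sumr.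
by apply: eq_big => [l|l _]; [rewrite eq_sym|rewrite -mulrA].
Qed.

Lemma block_plan_sumr l : \sum_k block_plan q r s k l =
  s l * block_sum q r (q l) / Num.max (block_sum q r (q l)) (block_sum q s (q l)).
Proof.
rewrite /block_plan -big_mkcond/= -mulrA [X in _ * (X / _)]/block_sum.
rewrite mulr_suml mulr_sumr.
by apply: eq_bigr => k /eqP ->; rewrite mulrCA mulrA.
Qed.

Let ratio_le (x u v : R) : 0 <= x -> 0 <= u -> u <= v -> x * u / v <= x.
Proof.
move=> x0 u0 uv; have [v0|v0] := eqVneq v 0; first by rewrite v0 invr0 mulr0.
by rewrite ler_pdivrMr ?ler_wpM2l// lt_neqAle eq_sym v0 (le_trans u0).
Qed.

Lemma block_plan_suml_le k : \sum_l block_plan q r s k l <= r k.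
Proof.
rewrite block_plan_suml ratio_le ?block_sum_ge0//.
by rewrite le_max lexx orbT.
Qed.

Lemma block_plan_sumr_le l : \sum_k block_plan q r s k l <= s l.
Proof.
by rewrite block_plan_sumr ratio_le ?block_sum_ge0// le_max lexx.
Qed.

(** The maximum equals the block mass of the larger side, so each row (or column) of the smaller
    side is multiplied by u / u. If u = 0 the smaller side vanishes on the block as well, and 0 / 0
    = 0 gives the right value. *)
Lemma block_plan_exhaust (c : B) :
  (forall k, q k = c -> \sum_l block_plan q r s k l = r k) \/
  (forall l, q l = c -> \sum_k block_plan q r s k l = s l).
Proof.
have full (x u : R) : (u = 0 -> x = 0) -> x * u / u = x.
  move=> ux; have [u0|u0] := eqVneq u 0; first by rewrite u0 invr0 mulr0 ux.
  by rewrite mulfK.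
have [rs|/ltW sr] := leP (block_sum q r c) (block_sum q s c); [left|right].
- move=> k qk; rewrite block_plan_suml qk max_r// full// => s_eq0.
  by apply/eqP; rewrite eq_le r0 andbT -s_eq0 (le_trans _ rs)// -qk le_block_sum.
- move=> l ql; rewrite block_plan_sumr ql max_l// full// => r_eq0.
  by apply/eqP; rewrite eq_le s0 andbT -r_eq0 (le_trans _ sr)// -ql le_block_sum.
Qed.

(** Each unit of mass moved pays [h] at its source and [h] at its target; the marginals of the plan
    are at most [r] and [s]. *)
Lemma block_plan_cost D (h : K -> R) :
  (forall k, 0 <= h k) ->
  (forall k l, q k = q l -> D k l <= h k + h l) ->
  \sum_k \sum_l block_plan q r s k l * D k l <= \sum_k h k * (r k + s k).
Proof.
move=> h0 Dh.
apply: (@le_trans _ _ (\sum_k \sum_l block_plan q r s k l * (h k + h l))).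
  apply: ler_sum => k _; apply: ler_sum => l _.
  have [qkl|qkl] := eqVneq (q k) (q l); last by rewrite block_plan_out ?mul0r.
  by rewrite ler_wpM2l ?block_plan_ge0 ?Dh.
under eq_bigr do under eq_bigr do rewrite mulrDr.
under eq_bigr do rewrite big_split/=.
rewrite big_split/= [X in _ + X]exchange_big/=.
under [X in _ <= X]eq_bigr do rewrite mulrDr.
rewrite [leRHS]big_split/= lerD//; apply: ler_sum => k _.
  by rewrite -mulr_suml mulrC ler_wpM2l ?block_plan_suml_le.
by rewrite -mulr_suml mulrC ler_wpM2l ?block_plan_sumr_le.
Qed.

End block_plan_theory.

(* After the plan has been built up to level t, no block of level t contains
   remaining mass of both sides; hence the remaining mass of a block is the
   absolute difference of the two total masses. *)
Lemma tree_transport (q : nat -> K -> B) (H : nat -> B -> R) (rho : K -> R)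
    D a b (T : nat) :
  (forall k, 0 <= a k) -> (forall k, 0 <= b k) ->
  \sum_k a k = \sum_k b k ->
  (forall t c, 0 <= H t c) ->
  (forall t k l, (t < T)%N -> q t k = q t l -> q t.+1 k = q t.+1 l) ->
  (forall k l, q T k = q T l) ->
  (forall k, 0 <= rho k) -> (forall k l, q 0 k = q 0 l -> D k l <= rho l) ->
  (forall t k l, (t < T)%N -> q t.+1 k = q t.+1 l ->
     D k l <= H t (q t k) + H t (q t l)) ->
  exists p : K -> K -> R,
    [/\ forall k l, 0 <= p k l,
        forall k, \sum_l p k l = a k, forall l, \sum_k p k l = b l &
        \sum_k \sum_l p k l * D k l <= \sum_k rho k * b k +
          \sum_(t < T) \sum_c H t c * `|block_sum (q t) a c - block_sum (q t) b c|].
Proof.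
move=> a0 b0 ab H0 qS qT rho0 Drho DH.
pose rest1 (p : K -> K -> R) k := a k - \sum_l p k l.
pose rest2 (p : K -> K -> R) l := b l - \sum_k p k l.
(* The invariant is a partial plan that moves mass only inside blocks of level T and exhausts one
   side in each of them. It is stated for any T to allow induction; by [qT] one side is then
   exhausted everywhere, and equality of the totals exhausts the other. *)
suff [p [p0 p12 pq pex pD]] : exists p : K -> K -> R,
    [/\ forall k l, 0 <= p k l,
        forall k, 0 <= rest1 p k /\ 0 <= rest2 p k,
        forall k l, q T k != q T l -> p k l = 0,
        forall c, (forall k, q T k = c -> rest1 p k = 0) \/
                  (forall l, q T l = c -> rest2 p l = 0) &
        \sum_k \sum_l p k l * D k l <= \sum_k rho k * b k +
          \sum_(t < T) \sum_c H t c * `|block_sum (q t) a c - block_sum (q t) b c|].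
  have rest_eq : \sum_k rest1 p k = \sum_l rest2 p l.
    by rewrite /rest1 /rest2 !sumrB ab exchange_big.
  have [K0|k0] := pickP K.
    2: { exists p; split=> // [k|l]; [by have := k0 k|by have := k0 l]. }
  have E12 : (forall k, rest1 p k = 0) /\ (forall l, rest2 p l = 0).
    have [r0|r0] := pex (q T K0).
      have r1 k : rest1 p k = 0 by apply: r0; exact: qT.
      split=> // l; move: rest_eq; rewrite big1// => /esym/eqP.
      rewrite psumr_eq0; last by move=> k _; case: (p12 k).
      by move=> /allP/(_ l); rewrite mem_index_enum => /(_ isT)/eqP.
    have r2 k : rest2 p k = 0 by apply: r0; exact: qT.
    split=> // l; move: rest_eq; rewrite [RHS]big1// => /eqP.
    rewrite psumr_eq0; last by move=> k _; case: (p12 k).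
    by move=> /allP/(_ l); rewrite mem_index_enum => /(_ isT)/eqP.
  exists p; split=> // k; apply/esym/eqP; rewrite -subr_eq0; apply/eqP.
    exact: E12.1.
  exact: E12.2.
elim: T {qT} qS DH => [|T IH] qS DH.
  exists (block_plan (q 0) a b); split.
  - exact: block_plan_ge0.
  - by move=> k; rewrite !subr_ge0 block_plan_suml_le ?block_plan_sumr_le.
  - exact: block_plan_out.
  - move=> c; have [h|h] := block_plan_exhaust (q 0) a0 b0 c; [left|right] => k /h;
    by rewrite /rest1 /rest2 => ->; rewrite subrr.
  (* At level 0 the cost is charged to the target alone. The target will be [alpha], so this term is
     not random. *)
  - rewrite big_ord0 addr0 exchange_big/=; apply: ler_sum => l _.
    apply: (@le_trans _ _ (\sum_k block_plan (q 0) a b k l * rho l)).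
      apply: ler_sum => k _.
      have [qkl|qkl] := eqVneq (q 0%N k) (q 0%N l); last by rewrite block_plan_out ?mul0r.
      by rewrite ler_wpM2l ?block_plan_ge0 ?Drho.
    by rewrite -mulr_suml mulrC ler_wpM2l// block_plan_sumr_le.
have [||p [p0 p12 pq pex pD]] := IH.
- by move=> t k l tT; apply: qS; rewrite ltnS ltnW.
- by move=> t k l tT; apply: DH; rewrite ltnS ltnW.
have p1 k : 0 <= rest1 p k by case: (p12 k).
have p2 k : 0 <= rest2 p k by case: (p12 k).
pose p' := block_plan (q T.+1) (rest1 p) (rest2 p).
have E1 k : rest1 (fun k l => p k l + p' k l) k = rest1 p k - \sum_l p' k l.
  by rewrite /rest1 big_split/= opprD addrA.
have E2 k : rest2 (fun k l => p k l + p' k l) k = rest2 p k - \sum_l p' l k.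
  by rewrite /rest2 big_split/= opprD addrA.
exists (fun k l => p k l + p' k l); split.
- by move=> k l; rewrite addr_ge0// block_plan_ge0.
- by move=> k; rewrite E1 E2 !subr_ge0 block_plan_suml_le ?block_plan_sumr_le.
- move=> k l qkl; rewrite /p' block_plan_out// addr0 pq//.
  by apply: contraNN qkl => /eqP/qS-/(_ (ltnSn T))->.
- move=> c; have [h|h] := block_plan_exhaust (q T.+1) p1 p2 c; [left|right] => k /h.
    by rewrite E1 /p' => ->; rewrite subrr.
  by rewrite E2 /p' => ->; rewrite subrr.
under eq_bigr do under eq_bigr do rewrite mulrDl.
under eq_bigr do rewrite big_split/=.
rewrite big_split/= big_ord_recr/= addrA lerD//.
apply: (@le_trans _ _ (\sum_k H T (q T k) * (rest1 p k + rest2 p k))).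
  by apply: block_plan_cost => // k l; exact: DH.
rewrite sum_block_sumM; apply: ler_sum => c _; rewrite ler_wpM2l//.
(* Mass moved so far stays inside blocks of level T, so it is subtracted equally from both sides of
   [c]. *)
have diff : block_sum (q T) (rest1 p) c - block_sum (q T) (rest2 p) c =
            block_sum (q T) a c - block_sum (q T) b c.
  rewrite /block_sum /rest1 /rest2 !sumrB.
  suff -> : \sum_(k | q T k == c) \sum_l p k l =
            \sum_(l | q T l == c) \sum_k p k l by ring.
  transitivity (\sum_(k | q T k == c) \sum_(l | q T l == c) p k l).
    apply: eq_bigr => k /eqP kc; rewrite [RHS]big_mkcond/=; apply: eq_bigr => l _.
    by case: ifP => // /negbT lc; apply: pq; rewrite kc eq_sym.
  rewrite exchange_big/=.
  apply: eq_bigr => k /eqP kc; rewrite big_mkcond/=; apply: eq_bigr => l _.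
  by case: ifP => // /negbT lc; rewrite pq// kc.
rewrite -diff /block_sum big_split/=.
have [r0|r0] := pex c.
  rewrite ![\sum_(i | _) rest1 p i]big1; [|by move=> k /eqP/r0..].
  by rewrite add0r sub0r normrN ler_norm.
rewrite ![\sum_(i | _) rest2 p i]big1; [|by move=> k /eqP/r0..].
by rewrite addr0 subr0 ler_norm.
Qed.

End tree_transport.

(** * Gluing product measures along a finite plan *)

Section integral_lemmas.
Local Open Scope ereal_scope.
Context d (T : measurableType d) (R : realType).

(* The smaller function need not be measurable. *)
Lemma ge0_le_integral_nomeas (mu : {measure set T -> \bar R}) (f g : T -> \bar R) :
  (forall x, 0 <= f x) -> (forall x, f x <= g x) ->
  \int[mu]_x f x <= \int[mu]_x g x.
Proof.
move=> f0 fg; have g0 x : 0 <= g x by apply: le_trans (fg x).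
rewrite !ge0_integralTE//; apply: le_ereal_sup => _ [h hf <-].
by exists h => // x; apply: le_trans (fg x).
Qed.

Lemma measure_partition (K : finType) (mu : {measure set T -> \bar R})
    (kappa : T -> K) (A : set T) :
  (forall k, measurable (kappa @^-1` [set k])) -> measurable A ->
  mu A = \sum_k mu (A `&` kappa @^-1` [set k]).
Proof.
move=> mk mA.
rewrite (bigfs _ (index_enum_uniq K))//; last first.
  by move=> i _; rewrite mem_index_enum.
rewrite -measure_fin_bigcup//.
- congr (mu _); apply/seteqP; split => [x Ax|x [k _ []//]].
  by exists (kappa x).
- by apply/trivIsetP => k l _ _ kl; apply/seteqP; split => // x [[_ xk] [_ xl]];
    move/eqP: kl; apply; rewrite -xk -xl.
- by move=> k _; exact: measurableI.
Qed.

End integral_lemmas.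

Section finite_coupling.
Context d (T : measurableType d) (R : realType) (K : finType)
  (mu nu : probability T R) (kappa : T -> K)
  (mk : forall k, measurable (kappa @^-1` [set k])) (p : K -> K -> R)
  (p0 : forall k l, 0 <= p k l)
  (p1 : forall k, \sum_l p k l = fine (mu (kappa @^-1` [set k])))
  (p2 : forall l, \sum_k p k l = fine (nu (kappa @^-1` [set l]))).

Let C k := kappa @^-1` [set k].
Let a k := fine (mu (C k)).
Let b k := fine (nu (C k)).

Let w_ge0 k l : 0 <= p k l / (a k * b l).
Proof. by rewrite divr_ge0// mulr_ge0// fine_ge0. Qed.

Let mrect k l : measurable (C k `*` C l).
Proof. by apply: measurableX; exact: mk. Qed.

(** A measure of mass p k l on the rectangle. If a k or b l vanishes, then p k l = 0 too, and the
    weight 0 produced by the division is the correct one. *)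
Definition block_product (kl : K * K) : {measure set (T * T) -> \bar R} :=
  mscale (NngNum (w_ge0 kl.1 kl.2)) (mrestr (mu \x nu)%E (mrect kl.1 kl.2)).

(** [msum] takes a family indexed by [nat], whence the enumeration of pairs; [None] is only the
    default value of [nth]. *)
Definition glued : set (T * T) -> \bar R :=
  msum (fun i => if nth None (map Some (index_enum (K * K)%type)) i is Some kl
                 then block_product kl else mzero) #|{: K * K}|.

HB.instance Definition _ := Measure.on glued.

Lemma gluedE A B : measurable A -> measurable B ->
  glued (A `*` B) = (\sum_k \sum_l
    (p k l / (a k * b l) * (fine (mu (A `&` C k)) * fine (nu (B `&` C l))))%:E)%E.
Proof.
move=> mA mB; rewrite pair_big/= /glued /msum.
set s := map _ _; have sz : size s = #|{: K * K}|.
  rewrite size_map -(card_uniqP (index_enum_uniq _)).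
  by apply: eq_card => x; rewrite mem_index_enum.
transitivity (\sum_(i <- s) (if i is Some kl then block_product kl (A `*` B) else 0))%E.
  rewrite (big_nth None) big_mkord sz; apply: eq_bigr => i _.
  by case: nth.
rewrite big_map; apply: eq_bigr => -[k l] _ /=.
rewrite /block_product/= /mscale/= /mrestr -setXI.
have mAk := measurableI _ _ mA (mk k); have mBl := measurableI _ _ mB (mk l).
by rewrite product_measure1E// [RHS]EFinM [(fine _ * _)%:E]EFinM !fineK ?fin_num_measure.
Qed.

Let bC l : \sum_k p k l = b l. Proof. exact: p2. Qed.

Let aA (A : set T) k : measurable A -> fine (mu (A `&` C k)) <= a k.
Proof.
move=> mA; have mAk := measurableI _ _ mA (mk k).
have mCk : measurable (C k) by exact: mk.
by apply: fine_le; rewrite ?fin_num_measure ?le_measure ?inE//; exact: subIsetr.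
Qed.

Let bA (A : set T) k : measurable A -> fine (nu (A `&` C k)) <= b k.
Proof.
move=> mA; rewrite /b.
have mAk := measurableI _ _ mA (mk k).
have mCk : measurable (C k) by exact: mk.
by apply: fine_le; rewrite ?fin_num_measure ?le_measure ?inE//; exact: subIsetr.
Qed.

Let fine_partition (m : probability T R) (A : set T) : measurable A ->
  (\sum_k fine (m (A `&` C k)))%:E = m A.
Proof.
move=> mA; rewrite (measure_partition m mk mA) -sumEFin.
apply: eq_bigr => k _; have mAk := measurableI _ _ mA (mk k).
by rewrite fineK// fin_num_measure.
Qed.

(** A vanishing b l forces its column of [p] to vanish, so b l can always be cancelled. The right
    side is left unsimplified because it is 0 when a k = 0. *)
Let weight_suml k : \sum_l p k l / (a k * b l) * b l = (a k)^-1 * a k.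
Proof.
rewrite [RHS]mulrC -[X in _ = X / _]p1 mulr_suml; apply: eq_bigr => l _.
have [bl0|bl0] := eqVneq (b l) 0; last by rewrite invfM mulrA divfK.
suff -> : p k l = 0 by rewrite !mul0r.
by move: (bC l); rewrite bl0 => /eqP; rewrite psumr_eq0// => /allP/(_ k);
  rewrite mem_index_enum => /(_ isT)/eqP.
Qed.

Let weight_sumr l : \sum_k p k l / (a k * b l) * a k = (b l)^-1 * b l.
Proof.
rewrite [RHS]mulrC -[X in _ = X / _]p2 mulr_suml; apply: eq_bigr => k _.
have [ak0|ak0] := eqVneq (a k) 0; last by rewrite [a k * _]mulrC invfM mulrA divfK.
suff -> : p k l = 0 by rewrite !mul0r.
by move: (p1 k); rewrite -/(C k) -/(a k) ak0 => /eqP; rewrite psumr_eq0// => /allP/(_ l);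
  rewrite mem_index_enum => /(_ isT)/eqP.
Qed.

Lemma glued_marginal1 A : measurable A -> glued (A `*` setT) = mu A.
Proof.
move=> mA; rewrite gluedE//.
under eq_bigr do under eq_bigr do rewrite setTI.
rewrite -fine_partition//.
under eq_bigr do rewrite sumEFin.
rewrite sumEFin; congr (_%:E); apply: eq_bigr => k _.
under eq_bigr do rewrite mulrCA mulrC.
rewrite -mulr_suml weight_suml.
have [ak0|ak0] := eqVneq (a k) 0; last by rewrite mulVf// mul1r.
have := aA k mA; rewrite ak0 mulr0 mul0r => le0.
by apply/esym/eqP; rewrite eq_le le0 fine_ge0.
Qed.

Lemma glued_marginal2 B : measurable B -> glued (setT `*` B) = nu B.
Proof.
move=> mB; rewrite gluedE//.
under eq_bigr do under eq_bigr do rewrite setTI.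
rewrite -fine_partition//.
under eq_bigr do rewrite sumEFin.
rewrite sumEFin; congr (_%:E); rewrite exchange_big/=; apply: eq_bigr => l _.
under eq_bigr do rewrite mulrA.
rewrite -mulr_suml weight_sumr.
have [bl0|bl0] := eqVneq (b l) 0; last by rewrite mulVf// mul1r.
have := bA l mB; rewrite bl0 mulr0 mul0r => le0.
by apply/esym/eqP; rewrite eq_le le0 fine_ge0.
Qed.

Lemma glued_block k l : glued (C k `*` C l) = (p k l)%:E.
Proof.
have CI i j : C i `&` C j = if i == j then C i else set0.
  case: eqP => [->|ij]; first by rewrite setIid.
  by apply/seteqP; split => // x [xi xj]; apply: ij; rewrite -xi -xj.
rewrite gluedE; [|exact: mk..].
rewrite (bigD1 k)//= [X in (_ + X)%E]big1 ?adde0; last first.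
  move=> i ik; apply: big1 => j _; rewrite CI eq_sym (negbTE ik) measure0/=.
  by rewrite mul0r mulr0.
rewrite (bigD1 l)//= [X in (_ + X)%E]big1 ?adde0; last first.
  move=> j jl; rewrite [C l `&` _]CI eq_sym (negbTE jl) measure0/=.
  by rewrite !mulr0.
rewrite !CI !eqxx; congr (_%:E).
have [ak0|ak0] := eqVneq (a k) 0.
  rewrite /a in ak0; rewrite ak0 mul0r mulr0; apply/esym.
  move: (p1 k); rewrite -/(C k) ak0 => /eqP; rewrite psumr_eq0// => /allP/(_ l).
  by rewrite mem_index_enum => /(_ isT)/eqP.
have [bl0|bl0] := eqVneq (b l) 0.
  rewrite /b in bl0; rewrite bl0 !mulr0; apply/esym.
  move: (p2 l); rewrite -/(C l) bl0 => /eqP; rewrite psumr_eq0// => /allP/(_ k).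
  by rewrite mem_index_enum => /(_ isT)/eqP.
by rewrite -/(a k) -/(b l) divfK// mulf_neq0.
Qed.

Let glued_setT : glued setT = 1%E.
Proof. by rewrite -setXTT glued_marginal1// probability_setT. Qed.

HB.instance Definition _ := Measure_isProbability.Build _ _ _ glued glued_setT.

Lemma finite_coupling_exists : exists g : probability (T * T)%type R,
  [/\ forall A, measurable A -> g (A `*` setT) = mu A,
      forall B, measurable B -> g (setT `*` B) = nu B &
      forall k l, g (C k `*` C l) = (p k l)%:E].
Proof.
exists glued; split; [exact: glued_marginal1|exact: glued_marginal2|].
exact: glued_block.
Qed.

End finite_coupling.

Section W1_blocks.
Context (R : realType) (d : nat) (K : finType)
  (mu nu : probability (borel_space R d) R) (kappa : borel_space R d -> K)
  (mk : forall k, measurable (kappa @^-1` [set k])).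

(** [D] need only control distances up to [e], which absorbs the unbounded region: the integral of e
    x + e y is the same for every coupling, being determined by the marginals. *)
Lemma W1_le_block_coupling (p D : K -> K -> R) (e : borel_space R d -> R) :
  (forall k l, 0 <= p k l) ->
  (forall k, \sum_l p k l = fine (mu (kappa @^-1` [set k]))) ->
  (forall l, \sum_k p k l = fine (nu (kappa @^-1` [set l]))) ->
  (forall k l, 0 <= D k l) -> measurable_fun setT e -> (forall x, 0 <= e x) ->
  (forall x y : 'rV[R]_d,
     frobenius (x - y) <= D (kappa x) (kappa y) + e x + e y) ->
  (W1 mu nu <= (\sum_k \sum_l p k l * D k l)%:E
     + \int[mu]_x (e x)%:E + \int[nu]_x (e x)%:E)%E.
Proof.
move=> p0 p1 p2 D0 me e0 De.
have [g [g1 g2 gC]] := finite_coupling_exists mk p0 p1 p2.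
apply: (@le_trans _ _ (\int[g]_z (frobenius (z.1 - z.2 : 'rV[R]_d))%:E)%E).
  by apply: ereal_inf_lbound; exists g.
have mrect kl : measurable (kappa @^-1` [set kl.1] `*` kappa @^-1` [set kl.2]).
  by apply: measurableX; exact: mk.
have mI (A : set (borel_space R d * borel_space R d)%type) : measurable A ->
    measurable_fun setT (EFin \o (\1_A : _ -> R)).
  by move=> mA; apply/measurable_EFinP; exact: measurable_indic.
(* This is [D (kappa z.1) (kappa z.2)] as a sum of indicators, whose integral [gC] evaluates. *)
pose E1 (z : borel_space R d * borel_space R d) : \bar R :=
  (\sum_kl (D kl.1 kl.2)%:E *
    (\1_(kappa @^-1` [set kl.1] `*` kappa @^-1` [set kl.2]) z)%:E)%E.
have E10 z : (0 <= E1 z)%E.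
  by apply: sume_ge0 => kl _; rewrite mule_ge0// lee_fin.
have mE1 : measurable_fun setT E1.
  by apply: emeasurable_sum => kl; apply: emeasurable_funM => //; exact: mI.
have me1 : measurable_fun setT
    (fun z : borel_space R d * borel_space R d => (e z.1)%:E).
  by apply/measurable_EFinP; apply: measurableT_comp.
have me2 : measurable_fun setT
    (fun z : borel_space R d * borel_space R d => (e z.2)%:E).
  by apply/measurable_EFinP; apply: measurableT_comp.
apply: (@le_trans _ _ (\int[g]_z (E1 z + (e z.1)%:E + (e z.2)%:E))%E).
  apply: ge0_le_integral_nomeas => [z|z]; first by rewrite lee_fin sqrtr_ge0.
  rewrite (_ : E1 z = (D (kappa z.1) (kappa z.2))%:E) -?EFinD ?lee_fin ?De//.
  rewrite /E1 (bigD1 (kappa z.1, kappa z.2))//= indicE mem_set// mule1.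
  rewrite big1 ?adde0// => -[k l]; rewrite /= xpair_eqE => kl.
  rewrite indicE memNset ?mule0// => -[zk zl].
  by move: kl; rewrite -[k]zk -[l]zl !eqxx.
have e10 z : (0 <= (e (z : borel_space R d * borel_space R d).1)%:E)%E.
  by rewrite lee_fin.
have e20 z : (0 <= (e (z : borel_space R d * borel_space R d).2)%:E)%E.
  by rewrite lee_fin.
rewrite ge0_integralD//; [|by move=> z _; exact: adde_ge0|exact: emeasurable_funD].
rewrite ge0_integralD//.
apply: leeD; first apply: leeD.
- rewrite ge0_integral_sum//; last 2 first.
  + by move=> kl; apply: emeasurable_funM => //; exact: mI.
  + by move=> kl z _; rewrite mule_ge0// lee_fin.
  rewrite pair_big/= -sumEFin; apply: lee_sum => -[k l] _ /=.
  rewrite ge0_integralZl//; [|exact: (mI _ (mrect (k, l)))|by rewrite lee_fin].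
  rewrite integral_indic ?setIT//; last exact: (mrect (k, l)).
  by rewrite [X in (_ * X)%E](gC k l) -EFinM mulrC.
- rewrite (eq_measure_integral (pushforward g fst)); last first.
    move=> A mA _; rewrite [LHS](esym (g1 A mA)) /pushforward.
    by congr (g _); apply/seteqP; split => z //= [].
  rewrite ge0_integral_pushforward//; last by move=> x _; rewrite lee_fin.
  exact/measurable_EFinP.
- rewrite (eq_measure_integral (pushforward g snd)); last first.
    move=> A mA _; rewrite [LHS](esym (g2 A mA)) /pushforward.
    by congr (g _); apply/seteqP; split => z //= [].
  rewrite ge0_integral_pushforward//; last by move=> x _; rewrite lee_fin.
  exact/measurable_EFinP.
Qed.
End W1_blocks.

(** * Dyadic cells *)

Section frobenius_row.
Context (R : realType) (d : nat).
Implicit Types x y : 'rV[R]_d.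

Lemma frobenius_rowE x : frobenius x = Num.sqrt (\sum_j x 0 j ^+ 2).
Proof. by rewrite /frobenius big_ord1. Qed.

Lemma frobenius_ge0 x : 0 <= frobenius x.
Proof. exact: sqrtr_ge0. Qed.

Lemma sqr_frobenius x : frobenius x ^+ 2 = \sum_j x 0 j ^+ 2.
Proof. by rewrite frobenius_rowE sqr_sqrtr// sumr_ge0// => j _; exact: sqr_ge0. Qed.

Lemma coord_le_frobenius x j : `|x 0 j| <= frobenius x.
Proof.
rewrite -(@ler_pXn2r _ 2)// ?nnegrE ?frobenius_ge0// sqr_frobenius.
rewrite (bigD1 j)//= real_normK ?num_real// lerDl.
by rewrite sumr_ge0// => i _; exact: sqr_ge0.
Qed.

Lemma frobenius_le_coord x (c : R) : 0 <= c -> (forall j, `|x 0 j| <= c) ->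
  frobenius x <= d%:R * c.
Proof.
move=> c0 xc; rewrite -(@ler_pXn2r _ 2)// ?nnegrE ?frobenius_ge0 ?mulr_ge0//.
rewrite sqr_frobenius (@le_trans _ _ (\sum_(j < d) c ^+ 2))//.
  apply: ler_sum => j _; rewrite -(real_normK (num_real (x 0 j))).
  by rewrite ler_pXn2r ?nnegrE.
rewrite sumr_const card_ord -[leLHS]mulr_natl exprMn ler_wpM2r ?sqr_ge0//.
by rewrite -natrX ler_nat; case: (d) => // n; rewrite expnS leq_pmulr.
Qed.

(* The factor 2 makes Cauchy-Schwarz unnecessary. *)
Lemma frobeniusB_le x y : frobenius (x - y) <= 2 * frobenius x + 2 * frobenius y.
Proof.
have x0 := frobenius_ge0 x; have y0 := frobenius_ge0 y.
rewrite -(@ler_pXn2r _ 2)// ?nnegrE ?frobenius_ge0 ?addr_ge0 ?mulr_ge0//.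
apply: (@le_trans _ _ (2 * (frobenius x ^+ 2 + frobenius y ^+ 2))); last by nra.
rewrite !sqr_frobenius -big_split/= mulr_sumr; apply: ler_sum => j _.
by rewrite !mxE; have := sqr_ge0 (x 0 j + y 0 j); lra.
Qed.

Lemma measurable_coord j :
  measurable_fun [set: borel_space R d] (fun x : borel_space R d => (x : 'rV[R]_d) 0 j).
Proof.
apply: (measurability _ (RGenOpens.measurableE R)) => _ [_ [a [b ->]] <-].
rewrite setTI; apply: sub_sigma_algebra.
have cj : continuous (fun x : 'rV[R]_d => x 0 j) by move=> x; exact: coord_continuous.
by apply: (open_comp (fun x _ => cj x)); exact: interval_open.
Qed.

Lemma measurable_frobenius :
  measurable_fun [set: borel_space R d] (fun x : borel_space R d => frobenius (x : 'rV[R]_d)).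
Proof.
under [X in measurable_fun _ X]eq_fun do rewrite frobenius_rowE.
apply: measurableT_comp.
  by apply: continuous_measurable_fun; exact: sqrt_continuous.
apply: measurable_sum => j; apply: measurable_funX; exact: measurable_coord.
Qed.

End frobenius_row.

Section nat_measurability.
Context dd (T : measurableType dd).

Lemma measurable_nat_fiber (f : T -> nat) :
  (forall n, measurable [set x | (n < f x)%N]) ->
  forall q, measurable [set x | f x = q].
Proof.
move=> mf [|q].
  rewrite (_ : [set _ | _] = ~` [set x | (0 < f x)%N]); first exact: measurableC.
  by apply/seteqP; split => x /=; [move=> ->|case: (f x)].
rewrite (_ : [set _ | _] = [set x | (q < f x)%N] `\` [set x | (q.+1 < f x)%N]).
  exact: measurableD.
apply/seteqP; split => x /=; first by move=> ->; rewrite ltnS ltnn.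
by move=> [qf /negP]; rewrite -leqNgt => fq; apply/eqP; rewrite eqn_leq fq.
Qed.

End nat_measurability.

Section dyadic_cells.
Context (R : realType) (d : nat) (s : R) (L : nat).

(* Shell 0 is the ball of radius s, shell m is {2^(m-1) s < |x| <= 2^m s} for
   1 <= m <= L, and shell L.+1 is the complement of all these. *)
Definition shell (r : R) : nat := find (fun j => r <= 2 ^+ j * s) (iota 0 L.+1).

(* Index of a subinterval of length 2^(m-L) s of [- 2^m s, 2^m s]; the minimum
   makes it bounded for all t. *)
Definition cell_coord (m : nat) (t : R) : nat :=
  minn (Num.truncn (2 ^+ L * (t / (2 ^+ m * s) + 1))) (2 ^ L.+1).

(** One finite type labels both the cells and the blocks of all levels, as the fixed type [B] of
    [tree_transport] requires; many labels belong to empty sets. *)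
Definition cell_index : Type := ('I_L.+2 * {ffun 'I_d -> 'I_(2 ^ L.+1).+1})%type.

Definition cell (x : borel_space R d) : cell_index :=
  let m := shell (frobenius (x : 'rV[R]_d)) in
  (inord m, [ffun j => inord (cell_coord m ((x : 'rV[R]_d) 0 j))]).

Definition ord_div n t (i : 'I_n) : 'I_n :=
  Ordinal (leq_ltn_trans (leq_div i (2 ^ t)) (ltn_ord i)).

(* Label of the cube of side 2^(m-L+t) s containing the cell. *)
Definition coarsen (t : nat) (k : cell_index) : cell_index :=
  if (t <= L)%N then (k.1, [ffun j => ord_div t (k.2 j)])
  else (ord0, [ffun=> ord0]).

(** The value 0 in the outer shell makes its blocks free of charge; [tail_norm] pays for them. *)
Definition radius (k : cell_index) : R :=
  if (k.1 <= L)%N then 2 ^+ k.1 * s else 0.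

Definition block_diam (t : nat) (k : cell_index) : R :=
  2 * d%:R * radius k * (2 ^+ t / 2 ^+ L).

Definition tail_norm (x : borel_space R d) : R :=
  if 2 ^+ L * s < frobenius (x : 'rV[R]_d) then 2 * frobenius (x : 'rV[R]_d) else 0.

(** The best available bound on the distance between points of two cells. Being a minimum, it lies
    below every block diameter by construction, and geometry enters only in
    [frobenius_le_cell_dist]. *)
Definition cell_dist (k l : cell_index) : R :=
  \big[Order.min/2 * radius k + 2 * radius l]_(t < L.+1 | coarsen t k == coarsen t l)
    block_diam t k.

Context (s0 : 0 < s).

Let pow2_gt0 n : 0 < 2 ^+ n :> R. Proof. exact: exprn_gt0. Qed.

(** The thresholds 2^n s increase with n, so the first one reaching r comes after n exactly when the
    n-th fails. Membership and measurability of shells both reduce to this. *)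
Lemma shell_gt n (r : R) : (n < shell r)%N = (n <= L)%N && (2 ^+ n * s < r).
Proof.
apply/idP/andP => [nf|[nL nr]].
  have nL : (n < L.+1)%N.
    by rewrite (leq_trans nf)// -[leqRHS](size_iota 0) find_size.
  split=> //; have := before_find 0 nf.
  by rewrite nth_iota// add0n => /negbT; rewrite -ltNge.
rewrite ltnNge; apply/negP => fn.
have fL : (shell r < L.+1)%N by rewrite (leq_ltn_trans fn).
have : has (fun j => r <= 2 ^+ j * s) (iota 0 L.+1) by rewrite has_find size_iota.
move=> /(nth_find 0); rewrite -/(shell r) nth_iota// add0n => rf.
move: nr; rewrite ltNge => /negP; apply; apply: (le_trans rf).
by rewrite ler_pM2r// ler_eXn2l// ltr1n.
Qed.

Lemma shell_le (r : R) : (shell r <= L.+1)%N.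
Proof. by rewrite leqNgt shell_gt ltnn. Qed.

Lemma shell_inner (r : R) : (shell r <= L)%N -> r <= 2 ^+ shell r * s.
Proof. by move=> rL; have := shell_gt (shell r) r; rewrite ltnn rL/= ltNge => /esym/negbFE. Qed.

Lemma shell_outer (r : R) : (L < shell r)%N -> 2 ^+ L * s < r.
Proof. by rewrite shell_gt => /andP[]. Qed.

Lemma cell_coord_le m t : (cell_coord m t < (2 ^ L.+1).+1)%N.
Proof. by rewrite ltnS geq_minr. Qed.

Lemma radius_ge0 k : 0 <= radius k.
Proof. by rewrite /radius; case: ifP => // _; rewrite mulr_ge0// ltW. Qed.

Lemma block_diam_ge0 t k : 0 <= block_diam t k.
Proof. by rewrite /block_diam !mulr_ge0 ?radius_ge0// invr_ge0 ltW. Qed.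

Lemma tail_norm_ge0 x : 0 <= tail_norm x.
Proof. by rewrite /tail_norm; case: ifP => // _; rewrite mulr_ge0// frobenius_ge0. Qed.

Lemma radius_cellE (x : borel_space R d) : radius (cell x) =
  let m := shell (frobenius (x : 'rV[R]_d)) in if (m <= L)%N then 2 ^+ m * s else 0.
Proof. by rewrite /radius/= inordK// ltnS shell_le. Qed.

Lemma frobenius_le_radius (x : 'rV[R]_d) :
  2 * frobenius x <= 2 * radius (cell x) + tail_norm x.
Proof.
rewrite radius_cellE/= /tail_norm.
case: leqP => [xL|/shell_outer ->]; last by rewrite mulr0 add0r.
rewrite (@le_trans _ _ (2 * (2 ^+ shell (frobenius x) * s)))//.
  by rewrite ler_pM2l// shell_inner.
by rewrite lerDl; case: ifP => // _; rewrite mulr_ge0// frobenius_ge0.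
Qed.

(** In the rescaled coordinate [w], which ranges over [0, 2^(L+1)], a block of level t is an
    interval of length 2^t. The minimum in [cell_coord] is inactive there, the end point 2^(L+1)
    included. *)
Lemma cell_coord_dist m t (u v : R) : `|u| <= 2 ^+ m * s -> `|v| <= 2 ^+ m * s ->
  (cell_coord m u %/ 2 ^ t = cell_coord m v %/ 2 ^ t)%N ->
  `|u - v| <= 2 ^+ m * s * (2 ^+ t / 2 ^+ L).
Proof.
set ms := 2 ^+ m * s; have ms0 : 0 < ms by rewrite mulr_gt0.
pose w (u : R) := 2 ^+ L * (u / ms + 1).
have w_itv u0 : `|u0| <= ms -> cell_coord m u0 = Num.truncn (w u0) /\ 0 <= w u0.
  rewrite ler_norml => /andP[u1 u2].
  have u3 : u0 / ms <= 1 by rewrite ler_pdivrMr// mul1r.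
  have u4 : -1 <= u0 / ms by rewrite ler_pdivlMr// mulN1r.
  have w0 : 0 <= w u0 by rewrite mulr_ge0 ?(ltW (pow2_gt0 _))//; lra.
  split=> //; rewrite /cell_coord -/ms -/(w u0); apply/minn_idPl.
  rewrite -(ler_nat R) (@le_trans _ _ (w u0)) ?truncn_le//.
  by rewrite natrX exprSr ler_pM2l//; lra.
move=> /w_itv[-> wu0] /w_itv[-> wv0] uv.
have blk u0 : 0 <= w u0 -> let q := (Num.truncn (w u0) %/ 2 ^ t)%N in
    q%:R * 2 ^+ t <= w u0 /\ w u0 <= q%:R * 2 ^+ t + 2 ^+ t.
  move=> /truncn_itv/andP[a1 a2] q; split.
    by apply: le_trans a1; rewrite -natrX -natrM ler_nat leq_trunc_div.
  apply: (le_trans (ltW a2)); rewrite -natrX -natrM -natrD ler_nat.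
  by rewrite -mulSnr ltn_ceil// expn_gt0.
have [u1 u2] := blk _ wu0; have [v1 v2] := blk _ wv0.
rewrite uv in u1 u2.
have -> : u - v = ms * ((w u - w v) / 2 ^+ L).
  by rewrite /w; field; rewrite !gt_eqF.
rewrite normrM gtr0_norm// ler_pM2l// normrM [ `|_^-1| ]gtr0_norm ?invr_gt0//.
rewrite ler_pM2r ?invr_gt0// ler_norml.
by move: u1 u2 v1 v2; set Q := _%:R * _ => u1 u2 v1 v2; apply/andP; split; lra.
Qed.

Lemma coarsenS t k l : (t <= L)%N -> coarsen t k = coarsen t l ->
  coarsen t.+1 k = coarsen t.+1 l.
Proof.
rewrite /coarsen => tL; rewrite tL; case: ifP => // _ [-> /ffunP kl].
congr (_, _); apply/ffunP => j; apply/val_inj; have := kl j; rewrite !ffunE.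
by move=> /(congr1 val)/= E; rewrite [(2 ^ t.+1)%N]expnSr !divnMA E.
Qed.

Lemma coarsen_shell t k l : (t <= L)%N -> coarsen t k = coarsen t l -> k.1 = l.1.
Proof. by rewrite /coarsen => -> []. Qed.

Lemma coarsen_top k l : coarsen L.+1 k = coarsen L.+1 l.
Proof. by rewrite /coarsen ltnn. Qed.

Lemma block_diam_coarsen t k : (t <= L)%N ->
  block_diam t (coarsen t k) = block_diam t k.
Proof. by move=> tL; rewrite /block_diam /radius /coarsen tL. Qed.

Lemma block_diam_double t k : block_diam t.+1 k = block_diam t k + block_diam t k.
Proof. by rewrite /block_diam -mulrDr; congr (_ * _); rewrite exprS -mulrA mulr_natl mulr2n. Qed.

Lemma eq_radius k l : k.1 = l.1 -> radius k = radius l.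
Proof. by rewrite /radius => ->. Qed.

Lemma eq_block_diam t k l : k.1 = l.1 -> block_diam t k = block_diam t l.
Proof. by rewrite /block_diam => /eq_radius ->. Qed.

Lemma cell_dist_ge0 k l : 0 <= cell_dist k l.
Proof.
apply: le_bigmin => [|t _]; last exact: block_diam_ge0.
by rewrite addr_ge0// mulr_ge0// radius_ge0.
Qed.

Lemma cell_dist_le_diam t k l : (t <= L)%N -> coarsen t k = coarsen t l ->
  cell_dist k l <= block_diam t k.
Proof.
move=> tL kl; rewrite -ltnS in tL.
by apply: (bigmin_le_cond _ (j := Ordinal tL)); rewrite /= kl.
Qed.

Lemma cell_dist_le_step t k l : (0 < d)%N -> (t < L.+1)%N ->
  coarsen t.+1 k = coarsen t.+1 l ->
  cell_dist k l <= block_diam t (coarsen t k) + block_diam t (coarsen t l).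
Proof.
move=> d0 tL kl; rewrite !block_diam_coarsen//.
have [tL'|Lt] := ltnP t L.
  apply: (le_trans (cell_dist_le_diam tL' kl)).
  by rewrite block_diam_double (eq_block_diam t (coarsen_shell tL' kl)).
(* At the top the two cells may lie in different shells, and only the default value of the minimum
   is left. The factor 2 in [block_diam] makes 2 d radius >= 2 radius pay for it. *)
have -> : t = L by apply/eqP; rewrite eqn_leq Lt andbT -ltnS.
apply: (le_trans (bigmin_le_id _ _ _ _)).
rewrite /block_diam divff ?gt_eqF// !mulr1.
have d1 : 1 <= d%:R :> R by rewrite (ler_nat _ 1).
by rewrite lerD// ler_wpM2r ?radius_ge0//; lra.
Qed.

(** Every term of the minimum has to be a valid bound: the default by doubling the norms, a common
    block by comparing coordinates, and in the outer shell the two tails alone suffice. *)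
Lemma frobenius_le_cell_dist (x y : 'rV[R]_d) :
  frobenius (x - y) <= cell_dist (cell x) (cell y) + tail_norm x + tail_norm y.
Proof.
have Bxy := frobeniusB_le x y.
have Fx := frobenius_le_radius x; have Fy := frobenius_le_radius y.
rewrite -addrA -lerBlDr; apply: le_bigmin => [|t /eqP cxy]; first by lra.
have tL : (t <= L)%N by rewrite -ltnS.
have cxy1 := coarsen_shell tL cxy.
have [xL|xL] := leqP (shell (frobenius x)) L; last first.
  have := block_diam_ge0 t (cell x).
  have rx : radius (cell x) = 0 by rewrite radius_cellE/= leqNgt xL.
  have ry : radius (cell y) = 0 by rewrite -(eq_radius cxy1).
  by lra.
have exy : shell (frobenius x) = shell (frobenius y).
  by move: cxy1 => /(congr1 val)/=; rewrite !inordK ?ltnS ?shell_le.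
apply: (@le_trans _ _ (frobenius (x - y))).
  by rewrite gerBl addr_ge0// tail_norm_ge0.
have rx : radius (cell x) = 2 ^+ shell (frobenius x) * s by rewrite radius_cellE/= xL.
apply: (@le_trans _ _ (d%:R * (radius (cell x) * (2 ^+ t / 2 ^+ L)))).
  apply: frobenius_le_coord => [|j].
    by rewrite mulr_ge0 ?radius_ge0// divr_ge0// ltW.
  rewrite !mxE rx; apply: cell_coord_dist.
  - by rewrite (le_trans (coord_le_frobenius x j))// shell_inner.
  - by rewrite (le_trans (coord_le_frobenius y j))// exy shell_inner// -exy.
  - move: cxy; rewrite /coarsen tL => -[_ /ffunP/(_ j)]; rewrite !ffunE.
    by move=> /(congr1 val)/=; rewrite !inordK ?cell_coord_le// exy.
rewrite /block_diam -!mulrA ler_peMl ?ler1n//.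
by rewrite !mulr_ge0 ?radius_ge0// ?invr_ge0 ltW.
Qed.

Let measurable_frobenius_gt (c : R) :
  measurable [set x : borel_space R d | c < frobenius (x : 'rV[R]_d)].
Proof.
rewrite -[X in measurable X]setTI.
have := @measurable_frobenius R d measurableT `]c, +oo[%classic (measurable_itv _).
by congr measurable; apply/seteqP; split => x /=; rewrite in_itv/= andbT.
Qed.

Lemma measurable_shell m :
  measurable [set x : borel_space R d | shell (frobenius (x : 'rV[R]_d)) = m].
Proof.
apply: measurable_nat_fiber => n; under eq_set do rewrite shell_gt.
have [nL|nL] := boolP (n <= L)%N; first exact: measurable_frobenius_gt.
by rewrite (_ : [set _ | _] = set0)//; apply/seteqP; split.
Qed.

Lemma measurable_cell_coord m q j :
  measurable [set x : borel_space R d | cell_coord m ((x : 'rV[R]_d) 0 j) = q].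
Proof.
apply: measurable_nat_fiber => n; rewrite /cell_coord.
under eq_set do rewrite leq_min truncn_gt_nat.
have [nL|nL] := boolP (n < 2 ^ L.+1)%N; last first.
  by rewrite (_ : [set _ | _] = set0)//; apply/seteqP; split => x //= /andP[].
have mf : measurable_fun setT (fun x : borel_space R d =>
    2 ^+ L * ((x : 'rV[R]_d) 0 j / (2 ^+ m * s) + 1)).
  apply: measurable_funM => //; apply: measurable_funD => //.
  by apply: measurable_funM => //; exact: measurable_coord.
rewrite -[X in measurable X]setTI.
have := mf measurableT `[n.+1%:R, +oo[%classic (measurable_itv _).
by congr measurable; apply/seteqP; split => x /=; rewrite in_itv/= !andbT.
Qed.

Lemma measurable_cell (k : cell_index) : measurable (cell @^-1` [set k]).
Proof.
rewrite (_ : _ @^-1` _ = [set x | shell (frobenius (x : 'rV[R]_d)) = k.1] `&`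
    \bigcap_(j in [set: 'I_d]) [set x | cell_coord k.1 ((x : 'rV[R]_d) 0 j) = k.2 j]).
  apply: measurableI; first exact: measurable_shell.
  by apply: fin_bigcap_measurable => // j _; exact: measurable_cell_coord.
apply/seteqP; split => [x <-|x [/= xk xj]]/=.
  rewrite inordK ?ltnS ?shell_le//; split=> // j _ /=.
  by rewrite ffunE inordK// cell_coord_le.
rewrite [k]surjective_pairing /cell xk inord_val; congr (_, _).
by apply/ffunP => j; rewrite ffunE (xj j)// inord_val.
Qed.

Lemma measurable_tail_norm : measurable_fun setT tail_norm.
Proof.
apply: measurable_fun_ifT => //.
  exact: measurable_fun_ltr (measurable_cst _) (@measurable_frobenius R d).
by apply: measurable_funM => //; exact: measurable_frobenius.
Qed.

Lemma measurable_cell_fiber (Z : Type) (F : cell_index -> Z) (z : Z) :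
  measurable [set x | F (cell x) = z].
Proof.
rewrite (_ : [set _ | _] = \bigcup_(k in [set k | F k = z]) (cell @^-1` [set k])).
  by apply: fin_bigcup_measurable; [exact: finite_finset|move=> k _; exact: measurable_cell].
by apply/seteqP; split => [x xz|x [k kz xk]]/=; [exists (cell x)|rewrite [cell x]xk].
Qed.

Lemma coarsen_blockE (mu : probability (borel_space R d) R) t c :
  block_sum (coarsen t) (fun k => fine (mu (cell @^-1` [set k]))) c =
  fine (mu [set x | coarsen t (cell x) = c]).
Proof.
have mcell := measurable_cell; have mB := measurable_cell_fiber (coarsen t) c.
apply: EFin_inj; rewrite fineK ?fin_num_measure// (measure_partition mu mcell mB).
rewrite /block_sum big_mkcond/= -sumEFin; apply: eq_bigr => k _.
case: eqP => kc; last first.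
  rewrite (_ : _ `&` _ = set0) ?measure0//; apply/seteqP; split => // x [xc xk].
  by apply: kc; rewrite -[k]xk.
rewrite fineK ?fin_num_measure//; congr (mu _); apply/seteqP; split => x /=; last by case.
by move=> xk; rewrite xk.
Qed.

(** [cell_dist] joins the two halves: [tree_transport] needs it below the block diameters,
    [W1_le_block_coupling] needs it above the distance up to tails. *)
Lemma W1_le_cells (mu nu : probability (borel_space R d) R) : (0 < d)%N ->
  (W1 mu nu <= (\sum_k block_diam 0 k * fine (nu (cell @^-1` [set k])) +
      \sum_(t < L.+1) \sum_c block_diam t c *
        `|fine (mu [set x | coarsen t (cell x) = c]) -
          fine (nu [set x | coarsen t (cell x) = c])|)%:E
    + \int[mu]_x (tail_norm x)%:E + \int[nu]_x (tail_norm x)%:E)%E.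
Proof.
move=> d0.
have sum1 (m : probability (borel_space R d) R) :
    \sum_k fine (m (cell @^-1` [set k])) = 1.
  apply/EFin_inj; rewrite -sumEFin -[RHS](@probability_setT _ _ _ m).
  rewrite (measure_partition m measurable_cell measurableT).
  by apply: eq_bigr => k _; rewrite setTI fineK// fin_num_measure//; exact: measurable_cell.
have [|||||||||p [p0 p1 p2 pD]] := @tree_transport R cell_index cell_index coarsen
  block_diam (block_diam 0) cell_dist
  (fun k => fine (mu (cell @^-1` [set k]))) (fun k => fine (nu (cell @^-1` [set k]))) L.+1.
- by move=> k; rewrite fine_ge0.
- by move=> k; rewrite fine_ge0.
- by rewrite !sum1.
- exact: block_diam_ge0.
- by move=> t k l; rewrite ltnS; exact: coarsenS.
- exact: coarsen_top.
- by move=> k; exact: block_diam_ge0.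
- move=> k l kl; rewrite -(eq_block_diam 0 (coarsen_shell (leq0n L) kl)).
  exact: cell_dist_le_diam.
- by move=> t k l; exact: cell_dist_le_step.
apply: (le_trans (W1_le_block_coupling measurable_cell p0 p1 p2 cell_dist_ge0
  measurable_tail_norm tail_norm_ge0 frobenius_le_cell_dist)).
rewrite -!addeA leeD2r// lee_fin.
under [X in _ <= _ + X]eq_bigr do under eq_bigr do rewrite -!coarsen_blockE.
exact: pD.
Qed.

End dyadic_cells.

(** * Fluctuations of the empirical measure *)

Section empirical_probability.
Context (R : realType) (d : nat) (z : nat -> borel_space R d) (n : nat) (n0 : (0 < n)%N).

Lemma empirical_measureE (A : set (borel_space R d)) :
  empirical_measure z n A = (n%:R^-1 * \sum_(i < n) \1_A (z i))%:E.
Proof.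
rewrite /empirical_measure/= /mscale/= /msum EFinM; congr (_ * _)%E.
by rewrite -sumEFin; apply: eq_bigr => i _ /=; rewrite diracE indicE.
Qed.

Lemma integral_empirical_measure (e : borel_space R d -> R) :
  measurable_fun setT e -> (forall x, 0 <= e x) ->
  (\int[empirical_measure z n]_x (e x)%:E)%E = (n%:R^-1 * \sum_(i < n) e (z i))%:E.
Proof.
move=> me e0; have me' : measurable_fun setT (EFin \o e) by exact/measurable_EFinP.
rewrite ge0_integral_mscale//; last by move=> x _; rewrite lee_fin.
rewrite ge0_integral_measure_sum//; last by move=> x _; rewrite lee_fin.
rewrite EFinM -sumEFin; congr (_ * _)%E; apply: eq_bigr => i _.
by rewrite integral_dirac// diracT mul1e.
Qed.

Definition empirical_prob : set (borel_space R d) -> \bar R := empirical_measure z n.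

HB.instance Definition _ := Measure.on empirical_prob.

Let empirical_prob_setT : empirical_prob setT = 1%E.
Proof.
rewrite /empirical_prob empirical_measureE; congr (_%:E).
under eq_bigr do rewrite indicT.
by rewrite sumr_const card_ord mulVf// pnatr_eq0 -lt0n.
Qed.

HB.instance Definition _ :=
  Measure_isProbability.Build _ _ _ empirical_prob empirical_prob_setT.

(** [W1] and the stability constant speak of probabilities, whereas [empirical_measure] is only
    typed as a measure, since n = 0 is allowed there. *)
Lemma empirical_probability : exists m : probability (borel_space R d) R,
  (m : {measure set (borel_space R d) -> \bar R}) = empirical_measure z n.
Proof. by exists empirical_prob; apply: eq_measure. Qed.

End empirical_probability.

Section empirical_deviation.
Context (R : realType) (d : nat) (alpha : probability (borel_space R d) R)
  (disp : measure_display) (Omega : measurableType disp) (P : probability Omega R)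
  (y : nat -> {RV P >-> borel_space R d}) (iid : iid_with_law y alpha)
  (n : nat) (n0 : (0 < n)%N).
Implicit Types (B : set (borel_space R d)) (i j : nat).

Lemma iid_law i B : measurable B -> P (y i @^-1` B) = alpha B.
Proof. by case: iid => _ /(_ i B); exact. Qed.

Lemma iid_pair i j B : measurable B -> i != j ->
  P (y i @^-1` B `&` y j @^-1` B) = (alpha B * alpha B)%E.
Proof.
move=> mB ij; have := iid.1 [fset i; j]%fset (fun=> B) (fun=> mB).
rewrite big_fsetU1/= ?inE// big_seq_fset1 !iid_law// => <-; congr (P _).
apply/seteqP; split => [w [wi wj] k /=|w wk].
  by rewrite !inE => /orP[]/eqP ->.
by split; apply: wk; rewrite /= !inE eqxx ?orbT.
Qed.

Lemma iid_integral i (e : borel_space R d -> R) :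
  measurable_fun setT e -> (forall x, 0 <= e x) ->
  (\int[P]_w (e (y i w))%:E = \int[alpha]_x (e x)%:E)%E.
Proof.
move=> me e0.
rewrite [RHS](eq_measure_integral (pushforward P (y i))); last first.
  by move=> A mA _; exact/esym/iid_law.
rewrite ge0_integral_pushforward//; first exact/measurable_EFinP.
by move=> x _; rewrite lee_fin.
Qed.

Let q B := fine (alpha B).
Let S B w : R := n%:R^-1 * \sum_(i < n) \1_B (y i w).

Lemma measurable_empirical B : measurable B -> measurable_fun setT (S B).
Proof.
move=> mB; apply: measurable_funM => //; apply: measurable_sum => i.
by apply: measurableT_comp => //; exact: measurable_indic.
Qed.

Let mindic i B : measurable B -> measurable_fun setT (fun w => (\1_B (y i w) : R)).
Proof. by move=> mB; apply: measurableT_comp => //; exact: measurable_indic. Qed.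

Let integral_pair i j B : measurable B ->
  (\int[P]_w (\1_B (y i w) * \1_B (y j w) : R)%:E)%E =
  (if i == j then q B else q B ^+ 2)%:E.
Proof.
move=> mB.
have mi k : measurable (y k @^-1` B).
  by rewrite -[_ @^-1` _]setTI; exact: measurable_funP.
rewrite (eq_integral (fun w => (\1_(y i @^-1` B `&` y j @^-1` B) w)%:E)); last first.
  by move=> w _; rewrite indicI.
rewrite integral_indic ?setIT//; last exact: measurableI.
case: eqVneq => [->|ij].
  by rewrite setIid [LHS](iid_law j mB) fineK// fin_num_measure.
by rewrite [LHS](iid_pair mB ij) expr2 EFinM !fineK// fin_num_measure.
Qed.

Lemma integral_empirical B : measurable B -> (\int[P]_w (S B w)%:E)%E = (q B)%:E.
Proof.
move=> mB; under eq_integral do rewrite EFinM -sumEFin.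
rewrite ge0_integralZl//; last 2 first.
- by apply: emeasurable_sum => i; apply/measurable_EFinP; exact: mindic.
- by move=> w _; apply: sume_ge0 => i _; rewrite lee_fin.
rewrite ge0_integral_sum//; last first.
  by move=> i; apply/measurable_EFinP; exact: mindic.
have mI : measurable_fun setT (\1_B : borel_space R d -> R) by exact: measurable_indic.
have aB : alpha B = (q B)%:E by rewrite fineK// fin_num_measure.
rewrite (eq_bigr (fun=> (q B)%:E)); last first.
  by move=> i _; rewrite (iid_integral _ mI)// integral_indic// setIT [LHS]aB.
rewrite sumEFin -EFinM sumr_const card_ord -[q B *+ n]mulr_natl mulrA mulVf ?mul1r//.
by rewrite pnatr_eq0 -lt0n.
Qed.

(** In the expanded square the n diagonal pairs contribute q each, the n (n - 1) others q^2 by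
    independence. *)
Lemma integral_sqr_empirical B : measurable B ->
  (\int[P]_w (S B w ^+ 2)%:E)%E = (n%:R^-1 * q B + (1 - n%:R^-1) * q B ^+ 2)%:E.
Proof.
move=> mB.
have E w : (S B w ^+ 2)%:E = ((n%:R^-1 ^+ 2)%:E *
    \sum_(i < n) \sum_(j < n) (\1_B (y i w) * \1_B (y j w) : R)%:E)%E.
  under eq_bigr do rewrite sumEFin -mulr_sumr.
  by rewrite sumEFin -mulr_suml -EFinM /S exprMn expr2.
under eq_integral do rewrite E.
have mij i j : measurable_fun setT (fun w => (\1_B (y i w) * \1_B (y j w) : R)%:E).
  by apply/measurable_EFinP; apply: measurable_funM; exact: mindic.
have ge0ij i j w : (0 <= (\1_B (y i w) * \1_B (y j w) : R)%:E)%E.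
  by rewrite lee_fin mulr_ge0.
rewrite ge0_integralZl//; last 2 first.
- by apply: emeasurable_sum => i; apply: emeasurable_sum => j.
- by move=> w _; apply: sume_ge0 => i _; apply: sume_ge0.
rewrite ge0_integral_sum//; last 2 first.
- by move=> i; apply: emeasurable_sum => j.
- by move=> i w _; apply: sume_ge0.
under eq_bigr do (rewrite ge0_integral_sum//; under eq_bigr do rewrite integral_pair//).
under eq_bigr do rewrite sumEFin.
rewrite sumEFin -EFinM; congr (_%:E).
have -> : \sum_(i < n) \sum_(j < n) (if i == j :> nat then q B else q B ^+ 2) =
    n%:R * (q B + (n%:R - 1) * q B ^+ 2).
  transitivity (\sum_(i < n) (q B + (n%:R - 1) * q B ^+ 2)); last first.
    by rewrite sumr_const card_ord mulr_natl.
  apply: eq_bigr => i _.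
  rewrite (eq_bigr (fun j : 'I_n => q B ^+ 2 + (i == j)%:R * (q B - q B ^+ 2))); last first.
    by move=> j _; rewrite (inj_eq val_inj); case: eqP => _; rewrite ?mul1r ?mul0r; ring.
  rewrite big_split/= sumr_const card_ord (bigD1 i)//= eqxx big1 ?addr0; last first.
    by move=> j ji; rewrite eq_sym (negbTE ji) mul0r.
  by rewrite /= -[_ *+ n]mulr_natl mul1r; ring.
have nn0 : n%:R != 0 :> R by rewrite pnatr_eq0 -lt0n.
by field.
Qed.

(* |S - q| <= (S - q)^2 / (2 tau) + tau / 2, and 2 q S is moved to the left so
   that only nonnegative functions are integrated. *)
Lemma integral_empirical_deviation B (tau : R) : measurable B -> 0 < tau ->
  (\int[P]_w (`|S B w - q B|)%:E <= (q B / n%:R / (2 * tau) + tau / 2)%:E)%E.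
Proof.
move=> mB tau0; have mS := measurable_empirical mB.
have q0 : 0 <= q B by rewrite fine_ge0.
have S0 w : 0 <= S B w by rewrite mulr_ge0// sumr_ge0// => i _.
have mX : measurable_fun setT (fun w => (`|S B w - q B|)%:E).
  by apply/measurable_EFinP; apply: measurableT_comp => //; exact: measurable_funB.
have mqS : measurable_fun setT (fun w => (q B / tau * S B w)%:E).
  by apply/measurable_EFinP; exact: measurable_funM.
have IqS : (\int[P]_w (q B / tau * S B w)%:E)%E = (q B / tau * q B)%:E.
  under eq_integral do rewrite EFinM.
  have qt0 : (0 <= (q B / tau)%:E)%E by rewrite lee_fin divr_ge0// ltW.
  rewrite ge0_integralZl// ?integral_empirical//; first exact/measurable_EFinP.
  by move=> w _; rewrite lee_fin.
have cst0 : 0 <= q B ^+ 2 / (2 * tau) + tau / 2.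
  by rewrite addr_ge0 ?divr_ge0 ?sqr_ge0// ?mulr_ge0// ltW.
suff : (\int[P]_w (`|S B w - q B|)%:E + \int[P]_w (q B / tau * S B w)%:E <=
    ((2 * tau)^-1 * (n%:R^-1 * q B + (1 - n%:R^-1) * q B ^+ 2)
      + (q B ^+ 2 / (2 * tau) + tau / 2))%:E)%E.
  rewrite IqS -leeBrDr// -EFinB => /le_trans; apply; rewrite lee_fin.
  (* The terms in q^2 cancel except for the negative part of the variance (q - q^2) / n, which is
     dropped. *)
  have -> : (2 * tau)^-1 * (n%:R^-1 * q B + (1 - n%:R^-1) * q B ^+ 2) +
    (q B ^+ 2 / (2 * tau) + tau / 2) - q B / tau * q B =
    q B / n%:R / (2 * tau) + tau / 2 - q B ^+ 2 / n%:R / (2 * tau).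
    by field; rewrite !gt_eqF// ltr0n.
  by rewrite lerBlDr lerDl divr_ge0 ?divr_ge0 ?sqr_ge0 ?mulr_ge0// ltW.
rewrite -ge0_integralD//; last first.
  by move=> w _; rewrite lee_fin mulr_ge0// divr_ge0// ltW.
have mS2 : measurable_fun setT (fun w => (S B w ^+ 2)%:E).
  by apply/measurable_EFinP; exact: measurable_funX.
have S20 w : (0 <= (S B w ^+ 2)%:E)%E by rewrite lee_fin sqr_ge0.
have t0 : (0 <= ((2 * tau)^-1)%:E)%E by rewrite lee_fin invr_ge0 mulr_ge0// ltW.
have -> : ((2 * tau)^-1 * (n%:R^-1 * q B + (1 - n%:R^-1) * q B ^+ 2)
      + (q B ^+ 2 / (2 * tau) + tau / 2))%:E =
    (\int[P]_w (((2 * tau)^-1)%:E * (S B w ^+ 2)%:E +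
      (q B ^+ 2 / (2 * tau) + tau / 2)%:E))%E.
  rewrite ge0_integralD//; last 2 first.
  - by move=> w _; rewrite mule_ge0.
  - by apply: emeasurable_funM.
  rewrite ge0_integralZl// integral_sqr_empirical// integral_cst//.
  by rewrite [X in (_ + _ * X)%E]probability_setT mule1 EFinD EFinM.
apply: ge0_le_integral_nomeas => w.
  by rewrite adde_ge0// lee_fin mulr_ge0// divr_ge0// ltW.
rewrite -EFinM -!EFinD lee_fin.
set X := S B w - q B.
have -> : S B w = X + q B by rewrite subrK.
rewrite -subr_ge0.
have -> : (2 * tau)^-1 * (X + q B) ^+ 2 + (q B ^+ 2 / (2 * tau) + tau / 2) -
    (`|X| + q B / tau * (X + q B)) = (2 * tau)^-1 * (`|X| - tau) ^+ 2.
  have X2 : X ^+ 2 = `|X| ^+ 2 by rewrite real_normK// num_real.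
  have t1 : tau != 0 by rewrite gt_eqF.
  transitivity ((2 * tau)^-1 * X ^+ 2 + tau / 2 - `|X|); first by field.
  by rewrite X2; field.
by rewrite mulr_ge0 ?sqr_ge0// invr_ge0 mulr_ge0// ltW.
Qed.

End empirical_deviation.

(** * Consequences of the third moment bound *)

Section third_moment.
Context (R : realType) (d : nat) (alpha : probability (borel_space R d) R)
  (s : R) (L : nat) (s0 : 0 < s)
  (third : (\int[alpha]_x (frobenius (x : 'rV[R]_d) ^+ 3)%:E <= (s ^+ 3)%:E)%E).

Let mf3 : measurable_fun setT
  (fun x : borel_space R d => (frobenius (x : 'rV[R]_d) ^+ 3)%:E).
Proof. by apply/measurable_EFinP; apply: measurable_funX; exact: measurable_frobenius. Qed.

Let f30 (x : borel_space R d) : (0 <= (frobenius (x : 'rV[R]_d) ^+ 3)%:E)%E.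
Proof. by rewrite lee_fin exprn_ge0// frobenius_ge0. Qed.

Lemma tail_probability_le (A : set (borel_space R d)) (c : R) : measurable A ->
  0 < c -> (forall x, A x -> c < frobenius (x : 'rV[R]_d)) ->
  fine (alpha A) <= s ^+ 3 / c ^+ 3.
Proof.
move=> mA c0 Ac; rewrite ler_pdivlMr ?exprn_gt0// -lee_fin.
apply: le_trans third; rewrite EFinM fineK ?fin_num_measure// muleC.
have mI : measurable_fun setT (fun x => (\1_A x : R)%:E).
  by apply/measurable_EFinP; exact: measurable_indic.
rewrite (_ : alpha A = \int[alpha]_x (\1_A x)%:E)%E; last first.
  by rewrite integral_indic// setIT.
rewrite -ge0_integralZl//; last by rewrite lee_fin exprn_ge0// ltW.
apply: ge0_le_integral_nomeas => x; first by rewrite mule_ge0// lee_fin// exprn_ge0// ltW.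
rewrite indicE; have [/set_mem/Ac cx|_] := boolP (x \in A); last by rewrite mule0.
by rewrite mule1 lee_fin ler_pXn2r// ?nnegrE ltW// (lt_trans c0).
Qed.

(** Where |x| > 2^L s, one has 2 |x| <= 2 |x|^3 / (2^L s)^2. *)
Lemma integral_tail_norm_le :
  (\int[alpha]_x (tail_norm s L x)%:E <= (2 * s / 2 ^+ L / 2 ^+ L)%:E)%E.
Proof.
have p0 : 0 < 2 ^+ L :> R by rewrite exprn_gt0.
set p : R := 2 ^+ L in p0 *; have ps0 : 0 < p * s by rewrite mulr_gt0.
have -> : 2 * s / p / p = 2 / (p * s) ^+ 2 * s ^+ 3 by field; rewrite !gt_eqF.
have c0 : (0 <= (2 / (p * s) ^+ 2)%:E)%E by rewrite lee_fin divr_ge0// sqr_ge0.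
rewrite EFinM; apply: le_trans (lee_wpmul2l c0 third).
rewrite -ge0_integralZl//.
apply: ge0_le_integral_nomeas => x; first by rewrite lee_fin tail_norm_ge0.
rewrite -EFinM lee_fin /tail_norm -/p; have := frobenius_ge0 (x : 'rV[R]_d).
set r := frobenius _ => r0.
case: ifP => [pr|_]; last by rewrite mulr_ge0 ?exprn_ge0// divr_ge0// sqr_ge0.
rewrite mulrAC ler_pdivlMr ?exprn_gt0// -mulrA ler_pM2l// [r ^+ 3]exprS ler_wpM2l//.
by rewrite ler_pXn2r// ?nnegrE ltW.
Qed.

(** For m >= 1 the shell lies outside the ball of radius 2^(m-1) s, and Markov's inequality gives
    8^(-(m-1)); for m = 0 the bound 8 exceeds 1. *)
Lemma shell_probability_le m : (m <= L)%N ->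
  fine (alpha [set x | shell s L (frobenius (x : 'rV[R]_d)) = m]) <= 8 / 8 ^+ m.
Proof.
case: m => [|m] mL.
  have : fine (alpha [set x | shell s L (frobenius (x : 'rV[R]_d)) = 0%N]) <= 1.
    rewrite -lee_fin fineK ?fin_num_measure//; last exact: measurable_shell.
    by apply: probability_le1; exact: measurable_shell.
  by lra.
apply: (@le_trans _ _ (s ^+ 3 / (2 ^+ m * s) ^+ 3)).
  apply: tail_probability_le; first exact: measurable_shell.
    by rewrite mulr_gt0// exprn_gt0.
  by move=> x /= xm; have := shell_gt L s0 m (frobenius (x : 'rV[R]_d));
    rewrite xm ltnSn (ltnW mL)/= => /esym.
have -> : 8 / 8 ^+ m.+1 = (8 ^+ m)^-1 :> R by rewrite exprS invfM mulrA divff// mul1r.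
have -> : 8 = 2 ^+ 3 :> R by ring.
rewrite exprMn [(_ * s ^+ 3)^-1]invfM mulrCA mulfV ?mulr1 ?gt_eqF ?exprn_gt0//.
by rewrite exprAC.
Qed.

(** Applied with the identity for the smallest cells and with [coarsen t] for the blocks of level t;
    neither changes the shell. *)
Lemma shell_partition (F : cell_index d L -> cell_index d L) m :
  (forall k, (F k).1 = k.1) ->
  \sum_z fine (alpha [set x | F (cell s L x) = (m, z)]) =
  fine (alpha [set x | shell s L (frobenius (x : 'rV[R]_d)) = m]).
Proof.
move=> F1; have msh := @measurable_shell R d s L s0 m.
apply: EFin_inj; rewrite fineK ?fin_num_measure// -sumEFin.
rewrite (measure_partition alpha
  (kappa := fun x => (F (cell s L x)).2) _ msh); last first.
  by move=> z; exact: (measurable_cell_fiber s0 (fun k => (F k).2) z).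
apply: eq_bigr => z _.
rewrite fineK ?fin_num_measure//; last exact: (measurable_cell_fiber s0 F).
have cm x : (cell s L x).1 = m <-> shell s L (frobenius (x : 'rV[R]_d)) = m.
  rewrite /cell/=; split=> [<-|->]; last by rewrite inord_val.
  by rewrite inordK// ltnS shell_le.
congr (alpha _); apply/seteqP; split => [x /= xm|x /= [/cm xm <-]].
  by split; [apply/cm; rewrite -F1 xm|rewrite xm].
by rewrite -xm -F1 -surjective_pairing.
Qed.

End third_moment.

(** * Expectation of the transport cost *)

Section expectation.
Context (R : realType) (d : nat) (d0 : (0 < d)%N)
  (alpha : probability (borel_space R d) R)
  (disp : measure_display) (Omega : measurableType disp) (P : probability Omega R)
  (y : nat -> {RV P >-> borel_space R d}) (iid : iid_with_law y alpha)
  (n : nat) (n0 : (0 < n)%N) (s : R) (L : nat) (s0 : 0 < s).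

Let B t (c : cell_index d L) := [set x | coarsen t (cell s L x) = c].
Let q (A : set (borel_space R d)) := fine (alpha A).
Let S (A : set (borel_space R d)) w : R := n%:R^-1 * \sum_(i < n) \1_A (y i w).

(** [X] stands for the supremum distance and carries no measurability assumption; only its majorant,
    built from [g1] and [g2], is integrated term by term. [T] occurs twice, for the tails of the two
    measures. *)
Lemma expected_le_cells (X : Omega -> \bar R) (kappa T : R)
    (E : nat -> cell_index d L -> R) :
  0 <= kappa -> (forall w, 0 <= X w)%E ->
  (forall w (m : probability (borel_space R d) R),
    (m : {measure set (borel_space R d) -> \bar R}) =
      empirical_measure (fun i => y i w) n ->
    (X w <= kappa%:E * W1 m alpha)%E) ->
  (forall t c, (t <= L)%N ->
    (\int[P]_w (`|S (B t c) w - q (B t c)|)%:E <= (E t c)%:E)%E) ->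
  (\int[alpha]_x (tail_norm s L x)%:E <= T%:E)%E ->
  (\int[P]_w X w <=
   (kappa * (\sum_k block_diam s 0 k * q (cell s L @^-1` [set k]) +
     \sum_(t < L.+1) \sum_c block_diam s t c * E t c + (T + T)))%:E)%E.
Proof.
move=> k0 X0 XW EX iT.
have bd0 t c : 0 <= block_diam s t c by exact: block_diam_ge0.
have tn0 := @tail_norm_ge0 R d s L.
have mtn := @measurable_tail_norm R d s L.
set A := \sum_k _.
have A0 : 0 <= A by apply: sumr_ge0 => k _; rewrite mulr_ge0// fine_ge0.
have T0 : 0 <= T.
  rewrite -lee_fin; apply: le_trans iT; apply: integral_ge0 => x _.
  by rewrite lee_fin.
have mB t c : measurable (B t c) by exact: (measurable_cell_fiber s0 (coarsen t)).
pose g1 w := (\sum_(t < L.+1) \sum_c (block_diam s t c)%:E *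
  (`|S (B t c) w - q (B t c)|)%:E)%E.
pose g2 w := ((n%:R^-1)%:E * \sum_(i < n) (tail_norm s L (y i w))%:E)%E.
have mdev t c : measurable_fun setT (fun w => (`|S (B t c) w - q (B t c)|)%:E).
  apply/measurable_EFinP; apply: measurableT_comp => //; apply: measurable_funB => //.
  exact: measurable_empirical.
have mg1 : measurable_fun setT g1.
  apply: emeasurable_sum => t; apply: emeasurable_sum => c.
  exact: emeasurable_funM.
have mti i : measurable_fun setT (fun w => (tail_norm s L (y i w))%:E).
  by apply/measurable_EFinP; exact: measurableT_comp.
have mg2 : measurable_fun setT g2.
  by apply: emeasurable_funM => //; exact: emeasurable_sum.
have bd0' t c : (0 <= (block_diam s t c)%:E)%E by rewrite lee_fin.
have g10 w : (0 <= g1 w)%E.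
  by apply: sume_ge0 => t _; apply: sume_ge0 => c _; rewrite mule_ge0// lee_fin.
have ti0 i w : (0 <= (tail_norm s L (y i w))%:E)%E by rewrite lee_fin.
have g20 w : (0 <= g2 w)%E.
  by rewrite mule_ge0 ?lee_fin ?invr_ge0//; apply: sume_ge0.
have I1 : (\int[P]_w g1 w <= (\sum_(t < L.+1) \sum_c block_diam s t c * E t c)%:E)%E.
  rewrite ge0_integral_sum//; last 2 first.
  - by move=> t; apply: emeasurable_sum => c; exact: emeasurable_funM.
  - by move=> t w _; apply: sume_ge0 => c _; rewrite mule_ge0// lee_fin.
  rewrite -sumEFin; apply: lee_sum => t _.
  rewrite ge0_integral_sum//; last 2 first.
  - by move=> c; exact: emeasurable_funM.
  - by move=> c w _; rewrite mule_ge0// lee_fin.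
  rewrite -sumEFin; apply: lee_sum => c _.
  rewrite ge0_integralZl//.
  by rewrite [leRHS]EFinM; apply: lee_wpmul2l => //; apply: EX; rewrite -ltnS.
(* The mean tail of the empirical measure is the tail of its law [alpha]. *)
have I2 : (\int[P]_w g2 w <= T%:E)%E.
  rewrite ge0_integralZl//; last 2 first.
  - exact: emeasurable_sum.
  - by move=> w _; apply: sume_ge0.
  rewrite ge0_integral_sum//.
  under eq_bigr do rewrite (iid_integral iid _ mtn)//.
  rewrite (_ : T = n%:R^-1 * \sum_(i < n) T).
    by rewrite EFinM lee_wpmul2l ?lee_fin ?invr_ge0// -sumEFin; apply: lee_sum.
  by rewrite sumr_const card_ord -[T *+ n]mulr_natl mulrA mulVf ?mul1r// pnatr_eq0 -lt0n.
apply: (@le_trans _ _ (\int[P]_w (kappa%:E * ((A + T)%:E + (g1 w + g2 w))))%E).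
  apply: ge0_le_integral_nomeas => // w.
  have [m mE] := empirical_probability (fun i => y i w) n0.
  apply: (le_trans (XW w m mE)); rewrite lee_wpmul2l ?lee_fin//.
  apply: (le_trans (W1_le_cells L s0 m alpha d0)).
  have mE' D : m D = (S D w)%:E.
    by rewrite -[RHS](empirical_measureE (fun i => y i w)) -mE.
  have -> : (\int[m]_x (tail_norm s L x)%:E)%E = g2 w.
    rewrite (eq_measure_integral (empirical_measure (fun i => y i w) n)); last first.
      by move=> D _ _; rewrite -mE.
    by rewrite integral_empirical_measure// EFinM -sumEFin.
  rewrite -/A (EFinD A T) -addeA; move: (g2 w) (integral _ _ _) iT => G Ia iT.
  rewrite EFinD -!addeA leeD2l// [leRHS]addeC -[leRHS]addeA leeD//.
    rewrite -sumEFin; apply: lee_sum => t _; rewrite -sumEFin; apply: lee_sum => c _.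
    by rewrite EFinM mE'.
  by rewrite leeD2l.
rewrite ge0_integralZl//; last 2 first.
- by apply: emeasurable_funD => //; exact: emeasurable_funD.
- by move=> w _; rewrite adde_ge0 ?lee_fin ?addr_ge0// adde_ge0.
rewrite ge0_integralD//; last 3 first.
- by move=> w _; rewrite lee_fin addr_ge0.
- by move=> w _; rewrite adde_ge0.
- exact: emeasurable_funD.
rewrite ge0_integralD// integral_cst//.
rewrite [X in (_ * (_ * X + _))%E]probability_setT mule1 EFinM lee_wpmul2l ?lee_fin//.
rewrite (_ : A + _ + _ = A + T + (\sum_(t < L.+1) \sum_c block_diam s t c * E t c + T)).
  by rewrite [leRHS]EFinD leeD2l// [leRHS]EFinD; apply: leeD.
by ring.
Qed.

End expectation.

(** * Summation over blocks *)

Section sqrt2.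
Context (R : realType).

(** Half-integer powers of 2 are written as natural powers of this number. *)
Definition sqrt2 : R := Num.sqrt 2.

Lemma sqr_sqrt2 : sqrt2 ^+ 2 = 2.
Proof. by rewrite sqr_sqrtr. Qed.

(** A ratio of at least 4/3 gives both geometric sums below the constant 4 = 1 / (1 - 3/4). *)
Lemma sqrt2_ge : 4 / 3 <= sqrt2.
Proof.
have p : 0 <= sqrt2 by exact: sqrtr_ge0.
by rewrite -(@ler_pXn2r _ 2)// ?nnegrE// ?sqr_sqrt2; lra.
Qed.

Lemma sqrt2_gt0 : 0 < sqrt2.
Proof. by have := sqrt2_ge; lra. Qed.

Lemma geometric_sum_le (rho : R) k : 4 / 3 <= rho ->
  \sum_(i < k.+1) rho ^+ i <= 4 * rho ^+ k.
Proof.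
move=> rho43; elim: k => [|k IH]; first by rewrite big_ord_recl big_ord0 expr0; lra.
rewrite big_ord_recr/= exprS; have : 0 <= rho ^+ k by rewrite exprn_ge0//; lra.
move: IH; move: (\sum_(i < k.+1) _) (rho ^+ k) => S r; nra.
Qed.

Lemma inv_geometric_sum_le (rho : R) k : 4 / 3 <= rho ->
  \sum_(i < k) (rho ^+ i)^-1 <= 4.
Proof.
move=> rho43; have rho0 : 0 < rho by lra.
suff : \sum_(i < k) (rho ^+ i)^-1 <= 4 - 4 * (rho ^+ k)^-1.
  have : 0 <= (rho ^+ k)^-1 by rewrite invr_ge0 exprn_ge0// ltW.
  by lra.
elim: k => [|k IH]; first by rewrite big_ord0 expr0 invr1; lra.
rewrite big_ord_recr/= exprS invfM.
have r0 : 0 <= (rho ^+ k)^-1 by rewrite invr_ge0 exprn_ge0// ltW.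
have ri : rho^-1 <= 3 / 4.
  by rewrite -(invf_div 4 3) lef_pV2 // ?posrE //; lra.
move: IH r0 ri; move: (\sum_(i < k) _) ((rho ^+ k)^-1) (rho^-1) => S r ri; nra.
Qed.

End sqrt2.

Section cell_count.
Context (d L : nat).

(* The blocks of level t that are actually met by cells. *)
Definition admissible (t : nat) (z : {ffun 'I_d -> 'I_(2 ^ L.+1).+1}) :=
  [forall j, (z j <= 2 ^ (L.+1 - t))%N].

(** Each axis has 2^(L+1-t) + 1 values, the extra one coming from the right end point; this is at
    most 2^(L-t+2). *)
Lemma card_admissible t : (t <= L)%N ->
  (#|[pred z | admissible t z]| <= 2 ^ (d * (L - t).+2))%N.
Proof.
move=> tL; pose A := [pred a : 'I_(2 ^ L.+1).+1 | (a <= 2 ^ (L.+1 - t))%N].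
have -> : #|[pred z | admissible t z]| = #|[pred f : {ffun 'I_d -> 'I_(2 ^ L.+1).+1} | f \in ffun_on A]|.
  apply: eq_card => z; apply/idP/idP => [/forallP h|h].
    by apply/ffun_onP => j; rewrite inE; exact: h.
  by apply/forallP => j; have /ffun_onP/(_ j) := h; rewrite inE.
rewrite card_ffun_on card_ord mulnC expnM.
have cA : (#|A| <= 2 ^ (L - t).+2)%N.
  apply: (@leq_trans #|[seq (inord a : 'I_(2 ^ L.+1).+1) | a <- iota 0 (2 ^ (L.+1 - t)).+1]|).
    apply: subset_leq_card; apply/fintype.subsetP => a; rewrite inE => aL.
    by apply/mapP; exists (val a); rewrite ?inord_val// mem_iota.
  apply: (leq_trans (card_size _)); rewrite size_map size_iota subSn//.
  by rewrite [leqRHS]expnS mul2n -addnn -[leqLHS]addn1 leq_add2l expn_gt0.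
by elim: (d) => // k IH; rewrite [leqLHS]expnS [leqRHS]expnS leq_mul.
Qed.
End cell_count.

Section block_sums.
Context (R : realType) (d : nat) (d0 : (0 < d)%N)
  (alpha : probability (borel_space R d) R) (s : R) (L : nat) (s0 : 0 < s)
  (third : (\int[alpha]_x (frobenius (x : 'rV[R]_d) ^+ 3)%:E <= (s ^+ 3)%:E)%E)
  (n : nat) (n0 : (0 < n)%N).
Local Notation theta := (sqrt2 R).

Let q t (c : cell_index d L) := fine (alpha [set x | coarsen t (cell s L x) = c]).

(* The squares of these bound the mass of shell m and the number of blocks at
   depth i in one shell. *)
Definition shell_weight (m : nat) : R := theta ^+ 3 / theta ^+ (3 * m).
Definition count_weight (i : nat) : R := 2 ^+ d * theta ^+ (d * i).

Let r : R := Num.sqrt n%:R.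

(* This tau minimizes the sum of the deviation bounds over a shell. *)
Let tau t m : R := shell_weight m / (count_weight (L - t) * r).

(** Without the cut to admissible labels the term tau / 2 would be counted for all labels at every
    level, far more often than there are blocks. *)
Definition deviation_bound t (c : cell_index d L) : R :=
  if admissible t c.2 then q t c / n%:R / (2 * tau t c.1) + tau t c.1 / 2 else 0.

Lemma shell_weight_gt0 m : 0 < shell_weight m.
Proof. by rewrite divr_gt0// exprn_gt0// sqrt2_gt0. Qed.

Lemma count_weight_gt0 i : 0 < count_weight i.
Proof. by rewrite mulr_gt0// exprn_gt0// sqrt2_gt0. Qed.

Let r_gt0 : 0 < r. Proof. by rewrite sqrtr_gt0 ltr0n. Qed.

Let sqr_r : r ^+ 2 = n%:R. Proof. by rewrite sqr_sqrtr. Qed.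

Lemma sqr_shell_weight m : shell_weight m ^+ 2 = 8 / 8 ^+ m.
Proof.
have t6 : theta ^+ 6 = 8 by rewrite (exprM _ 2 3) sqr_sqrt2; ring.
rewrite /shell_weight expr_div_n -exprM t6; congr (_ / _).
by rewrite -exprM mulnAC exprM t6.
Qed.

Lemma sqr_count_weight i : count_weight i ^+ 2 = (2 ^ (d * i.+2))%:R.
Proof.
rewrite /count_weight exprMn -exprM [theta ^+ _ ^+ 2]exprAC sqr_sqrt2 -exprD natrX.
by congr (_ ^+ _); rewrite -mulnDr addnC addn2.
Qed.

Lemma tau_gt0 t m : 0 < tau t m.
Proof. by rewrite divr_gt0 ?shell_weight_gt0// mulr_gt0// count_weight_gt0. Qed.

(** With u and v the two weights and tau = u / (v r), the mass term and the counting term both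
    become u v / (2 r). *)
Lemma sum_deviation_bound t m : (t <= L)%N -> (m <= L)%N ->
  \sum_z deviation_bound t (inord m, z) <= shell_weight m * count_weight (L - t) / r.
Proof.
move=> tL mL; rewrite /deviation_bound/= inordK ?ltnS ?leqW//.
rewrite -big_mkcond/= big_split/= sumr_const.
set N := #|_|.
have NL : N%:R <= count_weight (L - t) ^+ 2 :> R.
  by rewrite sqr_count_weight ler_nat card_admissible.
have qm : \sum_(z | admissible t z) q t (inord m, z) <= shell_weight m ^+ 2.
  rewrite sqr_shell_weight; apply: le_trans (shell_probability_le s0 third mL).
  rewrite -{2}[m](@inordK L.+1 m) ?ltnS ?leqW//.
  rewrite -(shell_partition alpha s0 (F := coarsen t)); last first.
    by move=> k; rewrite /coarsen tL.
  rewrite big_mkcond/=; apply: ler_sum => z _; case: ifP => // _.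
  exact: fine_ge0.
have u0 := shell_weight_gt0 m; have v0 := count_weight_gt0 (L - t).
have t0 := tau_gt0 t m.
rewrite -2!mulr_suml.
apply: (@le_trans _ _ (shell_weight m ^+ 2 / n%:R / (2 * tau t m) +
    tau t m / 2 * count_weight (L - t) ^+ 2)).
  apply: lerD; last by rewrite -[leLHS]mulr_natr ler_wpM2l// divr_ge0// ltW.
  apply: ler_wpM2r; first by rewrite invr_ge0 mulr_ge0// ltW.
  by apply: ler_wpM2r; first by rewrite invr_ge0.
rewrite /tau -sqr_r.
move: (shell_weight m) (count_weight _) u0 v0 => u v u0 v0.
by rewrite le_eqVlt; apply/orP; left; apply/eqP; field; rewrite !gt_eqF.
Qed.

(* Empty blocks contribute nothing; the others are covered by the variance bound. *)
Lemma integral_deviation_le (disp : measure_display) (Omega : measurableType disp)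
    (P : probability Omega R) (y : nat -> {RV P >-> borel_space R d}) t c :
  iid_with_law y alpha -> (t <= L)%N ->
  (\int[P]_w (`|n%:R^-1 * (\sum_(i < n) \1_[set x | coarsen t (cell s L x) = c] (y i w))
      - fine (alpha [set x | coarsen t (cell s L x) = c])|)%:E <=
   (deviation_bound t c)%:E)%E.
Proof.
move=> iid tL; set B := [set x | _ = c]; have mB : measurable B by exact: (measurable_cell_fiber s0 (coarsen t)).
rewrite /deviation_bound; case: ifP => adm.
  by apply: (integral_empirical_deviation iid n0 mB); exact: tau_gt0.
have B0 : B = set0.
  apply/seteqP; split => // x xc; move: adm => /negbT/negP; apply.
  apply/forallP => j; move: xc; rewrite /B/= /coarsen tL => <-/=; rewrite ffunE/=.
  set a := _ j; have aL : (a <= 2 ^ L.+1)%N by rewrite -ltnS ltn_ord.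
  apply: (leq_trans (leq_div2r (2 ^ t) aL)).
  by rewrite -{1}(subnK (leqW tL)) expnD mulnK// expn_gt0.
rewrite (eq_integral (fun=> 0%E)) ?integral0// => w _.
rewrite B0 measure0 subr0 big1 ?mulr0 ?normr0// => i _.
by rewrite indic0.
Qed.

Let sum_block_diam_le t (G : cell_index d L -> R) (W : nat -> R) :
  (forall m, 0 <= W m) ->
  (forall m, (m <= L)%N -> \sum_z G (inord m, z) <= W m) ->
  \sum_(c : cell_index d L) block_diam s t c * G c <=
    2 * d%:R * s * (2 ^+ t / 2 ^+ L) * \sum_(m < L.+2) 2 ^+ m * W m.
Proof.
move=> W0 GW.
have tL0 : 0 <= 2 ^+ t / 2 ^+ L :> R by rewrite divr_ge0// exprn_ge0.
have -> : \sum_(c : cell_index d L) block_diam s t c * G c =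
    \sum_m \sum_z block_diam s t (m, z) * G (m, z).
  by rewrite pair_bigA; apply: eq_bigr => -[].
rewrite mulr_sumr; apply: ler_sum => m _; rewrite /block_diam/radius/=.
case: leqP => mL; last first.
  rewrite big1; last by move=> z _; rewrite mulr0 !mul0r.
  by rewrite !mulr_ge0// ?exprn_ge0// ltW.
rewrite -mulr_sumr -{2}(inord_val m).
have := GW m mL; move: (\sum_z _) (W m) (2 ^+ t / 2 ^+ L) tL0 => S w q0 q00 Sw.
rewrite [leLHS](_ : _ = 2 * d%:R * s * q0 * (2 ^+ m * S)); last by ring.
by rewrite ler_wpM2l ?ler_wpM2l ?exprn_ge0 ?mulr_ge0// ltW.
Qed.

(** Radius 2^m s against mass 8 / 8^m leaves 8 s / 4^m; the constant is 64 = 2 * 8 * 4, the last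
    factor bounding the geometric sum. *)
Lemma sum_leaf_diam :
  \sum_(k : cell_index d L) block_diam s 0 k * fine (alpha (cell s L @^-1` [set k])) <=
  64 * d%:R * s / 2 ^+ L.
Proof.
apply: le_trans (@sum_block_diam_le 0 _ (fun m => 8 / 8 ^+ m) _ _) _.
- by move=> m; rewrite divr_ge0// exprn_ge0.
- move=> m mL; apply: le_trans (shell_probability_le s0 third mL).
  rewrite -{2}[m](@inordK L.+1 m) ?ltnS ?leqW//.
  by rewrite -(shell_partition alpha s0 (F := id)).
have -> : \sum_(m < L.+2) 2 ^+ m * (8 / 8 ^+ m) = 8 * \sum_(m < L.+2) (4 ^+ m)^-1 :> R.
  rewrite mulr_sumr; apply: eq_bigr => m _.
  have -> : 8 = 2 * 4 :> R by ring.
  by rewrite exprMn; field; rewrite !expf_neq0.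
have : \sum_(m < L.+2) ((4 : R) ^+ m)^-1 <= 4 by apply: inv_geometric_sum_le; lra.
have L0 : 0 <= ((2 : R) ^+ L)^-1 by rewrite invr_ge0 exprn_ge0.
rewrite expr0 mul1r; move: (\sum_(m < _) _) ((2 ^+ L)^-1) L0 => S p p0 S4.
rewrite [leLHS](_ : _ = 16 * d%:R * s * p * S); last by ring.
rewrite [leRHS](_ : _ = 16 * d%:R * s * p * 4); last by ring.
by rewrite ler_wpM2l// !mulr_ge0// ltW.
Qed.

(** Since theta^(3 m) = theta^m 2^m, the radius 2^m leaves theta^(-m) of the shell weight, with sum
    at most 4. At depth i = L - t the side 2^(-i) meets the count theta^(d i), which gives the ratio
    theta^d / 2. *)
Lemma sum_block_diam_deviation :
  \sum_(t < L.+1) \sum_(c : cell_index d L) block_diam s t c * deviation_bound t c <=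
  8 * d%:R * 2 ^+ d * theta ^+ 3 * s / r * \sum_(i < L.+1) (theta ^+ d / 2) ^+ i.
Proof.
rewrite mulr_sumr [leRHS](reindex_inj rev_ord_inj)/=; apply: ler_sum => t _.
have tL : (t <= L)%N by rewrite -ltnS.
apply: le_trans (@sum_block_diam_le t _
  (fun m => shell_weight m * count_weight (L - t) / r) _ _) _.
- by move=> m; rewrite ltW// divr_gt0// mulr_gt0// ?shell_weight_gt0 ?count_weight_gt0.
- by move=> m; exact: sum_deviation_bound.
rewrite subSS.
have th0 := sqrt2_gt0 R.
have -> : \sum_(m < L.+2) 2 ^+ m * (shell_weight m * count_weight (L - t) / r) =
    theta ^+ 3 * count_weight (L - t) / r * \sum_(m < L.+2) (theta ^+ m)^-1.
  rewrite mulr_sumr; apply: eq_bigr => m _; rewrite /shell_weight.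
  have -> : theta ^+ (3 * m) = theta ^+ m * 2 ^+ m.
    by rewrite mulSn exprD exprM sqr_sqrt2.
  have : 0 < theta ^+ m by rewrite exprn_gt0.
  have : 0 < (2 : R) ^+ m by rewrite exprn_gt0.
  move: (theta ^+ m) (2 ^+ m) (count_weight _) => a b v b0 a0.
  by field; rewrite !gt_eqF.
have -> : (2 ^+ t / 2 ^+ L : R) = (2 ^+ (L - t))^-1.
  by rewrite -{2}(subnK tL) exprD invfM mulrCA mulfV ?mulr1// expf_neq0.
have : \sum_(m < L.+2) (theta ^+ m)^-1 <= 4 by apply: inv_geometric_sum_le; exact: sqrt2_ge.
rewrite /count_weight expr_div_n -exprM.
have : 0 <= theta ^+ (d * (L - t)) by rewrite exprn_ge0// ltW.
have : 0 <= ((2 : R) ^+ (L - t))^-1 by rewrite invr_ge0 exprn_ge0.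
have : 0 <= theta ^+ 3 by rewrite exprn_ge0// ltW.
have : 0 <= (2 : R) ^+ d by rewrite exprn_ge0.
have : 0 <= r^-1 by rewrite invr_ge0 ltW.
move: (\sum_(m < _) _) (2 ^+ d) (theta ^+ 3) ((2 ^+ (L - t))^-1) (theta ^+ (d * _)) (r^-1).
move=> S e c p v r' r'0 e0 c0 p0 v0 S4.
rewrite [leLHS](_ : _ = 2 * d%:R * s * p * c * e * v * r' * S); last by ring.
rewrite [leRHS](_ : _ = 2 * d%:R * s * p * c * e * v * r' * 4); last by ring.
by rewrite ler_wpM2l// !mulr_ge0// ltW.
Qed.

End block_sums.

(** * Choice of the depth *)

Section rates.
Context (R : realType).
Local Notation theta := (sqrt2 R).

Lemma depth_exists d n : (0 < d)%N -> (0 < n)%N ->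
  exists L, (n <= 2 ^ (d * L) <= 2 ^ d * n)%N.
Proof.
move=> d0 n0; have ex : exists L, (n <= 2 ^ (d * L))%N.
  by exists n; rewrite (leq_trans (ltnW (ltn_expl n (ltnSn 1))))// leq_exp2l// leq_pmull.
case: (ex_minnP ex) => L nL Lmin; exists L; rewrite nL/=.
case: L nL Lmin => [|L] _ Lmin; first by rewrite muln0 expn0 muln_gt0 expn_gt0.
rewrite mulnS expnD leq_mul2l; apply/orP; right; rewrite ltnW// ltnNge.
by apply/negP => /Lmin; rewrite ltnn.
Qed.

Lemma powRN_sqrt n : n%:R `^ (- 2^-1) = (Num.sqrt n%:R)^-1 :> R.
Proof. by rewrite powRN powR12_sqrt. Qed.

(** The summand of [rate] that depends on the dimension; [plain_rate_le] adds the nonnegative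
    n^(-2/3). *)
Definition plain_rate (d n : nat) : R :=
  match d with
  | 1 => (Num.sqrt n%:R)^-1
  | 2 => (Num.sqrt n%:R)^-1 * ln (1 + n%:R)
  | _ => n%:R `^ (- d%:R^-1)
  end.

Lemma plain_rate_le d n : plain_rate d n <= rate R d n.
Proof. by case: d => [|[|[|d]]]/=; rewrite ?powRN_sqrt lerDr powR_ge0. Qed.

(** The ratio theta^d / 2 decides: below 1 for d = 1 the sum is bounded, equal to 1 for d = 2 it is
    L + 1, hence the logarithm, and for d >= 3 it is at least theta and the last term dominates. *)
Lemma depth_rate d : (0 < d)%N -> exists c : R, 0 < c /\
  forall n, (0 < n)%N -> exists L,
    (2 ^+ L)^-1 <= c * plain_rate d n /\
    (Num.sqrt n%:R)^-1 * \sum_(i < L.+1) (theta ^+ d / 2) ^+ i <= c * plain_rate d n.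
Proof.
have th0 := sqrt2_gt0 R; have th2 := sqr_sqrt2 R; have th43 := sqrt2_ge R.
case: d => [//|[|[|d]]] _.
- exists 4; split; first by rewrite ltr0n.
  move=> n n0; have [L] := depth_exists (ltnSn 0) n0.
  rewrite mul1n => /andP[nL _]; exists L.
  have n1 : 1 <= n%:R :> R by rewrite ler1n.
  have r1 : 1 <= Num.sqrt n%:R :> R by rewrite -[leLHS](sqrtr1 R); exact: ler_wsqrtr.
  have r0 : 0 < Num.sqrt n%:R :> R by rewrite (lt_le_trans ltr01).
  have ri0 : 0 <= (Num.sqrt n%:R)^-1 :> R by rewrite invr_ge0 ltW.
  split.
    apply: (@le_trans _ _ (Num.sqrt n%:R)^-1); last by rewrite /plain_rate; lra.
    rewrite lef_pV2 ?posrE ?exprn_gt0//; apply: (@le_trans _ _ n%:R).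
      by rewrite -{2}[n%:R]sqr_sqrtr// expr2 ler_peMl// ltW.
    by rewrite -natrX ler_nat.
  rewrite mulrC /plain_rate ler_wpM2r// expr1.
  rewrite (eq_bigr (fun i : 'I_L.+1 => (theta ^+ i)^-1)) ?inv_geometric_sum_le// => i _.
  by rewrite -exprVn; congr (_ ^+ _); rewrite -th2; field; rewrite gt_eqF.
- have ln2 : 0 < ln (2 : R) by rewrite ln_gt0// ltr1n.
  (* With x = ln (1 + n) / ln 2 >= 1, the choice of L gives L - 1 <= x, so L + 1 <= x + 2 <= 3 x;
     [L.-1] covers L = 0. *)
  exists (3 / ln 2); split; first by rewrite divr_gt0.
  move=> n n0; have [L] := depth_exists (ltn0Sn 1) n0.
  move=> /andP[nL Ln]; exists L.
  have r0 : 0 < Num.sqrt n%:R :> R by rewrite sqrtr_gt0 ltr0n.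
  have n1 : 1 <= n%:R :> R by rewrite ler1n.
  have ln2n : ln 2 <= ln (1 + n%:R) :> R by rewrite ler_ln ?posrE//; lra.
  set l : R := ln (1 + n%:R) in ln2n *.
  have lq : 1 <= l / ln 2 by rewrite ler_pdivlMr// mul1r.
  rewrite /plain_rate -/l mulrCA; split.
    apply: (@le_trans _ _ (Num.sqrt n%:R)^-1).
      rewrite lef_pV2 ?posrE ?exprn_gt0// -(@ler_pXn2r _ 2)// ?nnegrE ?exprn_ge0 ?(ltW r0)//.
      by rewrite sqr_sqrtr// -exprM mulnC -natrX ler_nat.
    by rewrite ler_peMr ?invr_ge0 ?(ltW r0)// mulrAC -mulrA; lra.
  rewrite ler_wpM2l ?invr_ge0 ?(ltW r0)//.
  rewrite th2 divff//; under eq_bigr do rewrite expr1n.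
  rewrite sumr_const card_ord mulrAC -mulrA.
  suff : L.-1%:R <= l / ln 2.
    case: (L) => [|k]/=; last by rewrite -[k.+2]addn2 natrD; lra.
    by lra.
  case: L nL Ln => [|L] nL Ln /=; first exact: (le_trans ler01).
  rewrite ler_pdivlMr// mulr_natl -lnXn// ler_ln ?posrE ?exprn_gt0//.
  apply: (@le_trans _ _ n%:R); last by lra.
  rewrite -natrX ler_nat; apply: (@leq_trans (2 ^ (2 * L))); first by rewrite leq_exp2l// leq_pmull.
  by move: Ln; rewrite mulnS expnD leq_mul2l.
(* The 4 comes from the geometric sum, theta^D from the square root of 2^(D L) <= 2^D n. *)
- set D := d.+3; exists (4 * theta ^+ D); split; first by rewrite mulr_gt0// exprn_gt0.
  have thD : 1 <= theta ^+ D by rewrite exprn_ege1//; lra.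
  move=> n n0; have [L] := depth_exists (ltn0Sn d.+2) n0; rewrite -/D => /andP[nL Ln].
  exists L; rewrite /plain_rate /= -/D.
  have r0 : 0 < Num.sqrt n%:R :> R by rewrite sqrtr_gt0 ltr0n.
  have L2 : (2 ^+ L)^-1 <= n%:R `^ (- D%:R^-1) :> R.
    rewrite powRN lef_pV2 ?posrE ?exprn_gt0 ?powR_gt0 ?ltr0n//.
    have -> : 2 ^+ L = ((2 ^ (D * L))%:R : R) `^ D%:R^-1.
      rewrite mulnC expnM natrX natrX -[_ ^+ L ^+ D]powR_mulrn ?exprn_ge0// -powRrM divff ?powRr1//.
      by rewrite pnatr_eq0.
    by rewrite ge0_ler_powR ?nnegrE ?invr_ge0// ler_nat.
  split; first by rewrite (le_trans L2)// ler_peMl ?powR_ge0//; lra.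
  apply: (@le_trans _ _ (4 * theta ^+ D * (2 ^+ L)^-1)); last first.
    by rewrite ler_wpM2l// mulr_ge0// ltW// exprn_gt0.
  have rho : 4 / 3 <= theta ^+ D / 2.
    rewrite ler_pdivlMr//.
    have : theta ^+ 3 <= theta ^+ D by rewrite ler_weXn2l//; lra.
    by rewrite exprS th2; lra.
  rewrite mulrC ler_pdivrMr//; apply: (le_trans (geometric_sum_le L rho)).
  suff : (theta ^+ D / 2) ^+ L <= theta ^+ D * (2 ^+ L)^-1 * Num.sqrt n%:R.
    move: ((theta ^+ D / 2) ^+ L) (theta ^+ D) ((2 ^+ L)^-1) (Num.sqrt _) => a b c e.
    by lra.
  rewrite expr_div_n -exprM [leRHS]mulrAC ler_wpM2r ?invr_ge0 ?exprn_ge0//.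
  have rhs0 : 0 <= theta ^+ D * Num.sqrt n%:R := mulr_ge0 (exprn_ge0 D (ltW th0)) (ltW r0).
  have lhs0 : 0 <= theta ^+ (D * L) := exprn_ge0 _ (ltW th0).
  rewrite -(@ler_pXn2r _ 2)//.
  rewrite exprMn sqr_sqrtr// ![theta ^+ _ ^+ 2]exprAC th2.
  by rewrite -!natrX -natrM ler_nat.
Qed.

End rates.

(** * Sign of the normalizer and comparison of moments *)

Section normalizer_sign.
Context (R : realType) (d : nat) (f : R -> R).

Lemma kernel_mass_ge0 : admissible_profile d f -> (0 <= kernel_mass d f)%E.
Proof.
move=> fadm; apply: integral_ge0 => r /=; rewrite in_itv/= andbT => r0.
by rewrite lee_fin mulr_ge0 ?powR_ge0// (profile_ge0 fadm)// ltW.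
Qed.

Lemma sphere_area_ge0 : 0 <= sphere_area R d.
Proof.
rewrite /sphere_area divr_ge0 ?mulr_ge0 ?powR_ge0//.
apply: Rintegral_ge0 => t _.
by rewrite mulr_ge0 ?powR_ge0 ?expR_ge0.
Qed.

Lemma normalizer_ge0 sigma : admissible_profile d f -> 0 < sigma ->
  0 <= normalizer d f sigma.
Proof.
move=> fadm sigma0; have M0 := fine_ge0 (kernel_mass_ge0 fadm).
have s0 := exprn_ge0 d (ltW sigma0).
by apply: (mulr_ge0 (mulr_ge0 (mulr_ge0 _ s0) M0) sphere_area_ge0); rewrite invr_ge0.
Qed.

End normalizer_sign.

Section moments.
Context (R : realType) (d : nat).
Implicit Types alpha : {measure set (borel_space R d) -> \bar R}.

Lemma moment_integral3E alpha :
  moment_integral 3 alpha = (\int[alpha]_x (frobenius (x : 'rV[R]_d) ^+ 3)%:E)%E.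
Proof. by apply: eq_integral => x _; rewrite powR_mulrn// frobenius_ge0. Qed.

Lemma moment_integral1E alpha :
  moment_integral 1 alpha = (\int[alpha]_x (frobenius (x : 'rV[R]_d))%:E)%E.
Proof. by apply: eq_integral => x _; rewrite powRr1// frobenius_ge0. Qed.

Lemma moment_integral_ge0 p alpha : (0 <= moment_integral p alpha)%E.
Proof. by apply: integral_ge0 => x _; rewrite lee_fin powR_ge0. Qed.

Lemma moment_ge0 p alpha : 0 <= moment p alpha.
Proof. exact: powR_ge0. Qed.

Lemma moment_integral3_le alpha (s : R) : finite_moment 3 alpha -> moment 3 alpha <= s ->
  (\int[alpha]_x (frobenius (x : 'rV[R]_d) ^+ 3)%:E <= (s ^+ 3)%:E)%E.
Proof.
move=> fin3 ms; rewrite -moment_integral3E.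
have M0 := moment_integral_ge0 3 alpha.
have Mfin : moment_integral 3 alpha \is a fin_num by rewrite ge0_fin_numE.
rewrite -(fineK Mfin) lee_fin.
have -> : fine (moment_integral 3 alpha) = moment 3 alpha ^+ 3.
  rewrite /moment -powR_mulrn ?powR_ge0// -powRrM mulVf// powRr1//.
  exact: fine_ge0.
by rewrite ler_pXn2r// ?nnegrE ?moment_ge0// (le_trans (moment_ge0 _ _) ms).
Qed.

(** r <= 1 + r^3 and the total mass is 1. The stability constant is stated for measures with a first
    moment. *)
Lemma finite_moment3_1 (alpha : probability (borel_space R d) R) :
  finite_moment 3 alpha -> finite_moment 1 alpha.
Proof.
rewrite /finite_moment moment_integral3E moment_integral1E => fin3.
have mf3 : measurable_fun setT
    (fun x : borel_space R d => (frobenius (x : 'rV[R]_d) ^+ 3)%:E).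
  by apply/measurable_EFinP; apply: measurable_funX; exact: measurable_frobenius.
have f30 (x : borel_space R d) : (0 <= (frobenius (x : 'rV[R]_d) ^+ 3)%:E)%E.
  by rewrite lee_fin exprn_ge0// frobenius_ge0.
apply: (@le_lt_trans _ _
    (\int[alpha]_x (1%:E + (frobenius (x : 'rV[R]_d) ^+ 3)%:E))%E).
  apply: ge0_le_integral_nomeas => x; first by rewrite lee_fin frobenius_ge0.
  rewrite -EFinD lee_fin; have := frobenius_ge0 (x : 'rV[R]_d).
  move: (frobenius _) => r r0.
  have [r1|r1] := leP r 1; first by rewrite (le_trans r1)// lerDl exprn_ge0.
  by rewrite -[leLHS]add0r lerD// exprS ler_peMr// exprn_ege1// ltW.
rewrite ge0_integralD// integral_cst// [X in (_ * X)%E]probability_setT mule1.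
by rewrite lte_add_pinfty// ltry.
Qed.

End moments.

(** * The expected distance *)

Section expected_W1.
Context (R : realType) (d : nat) (d0 : (0 < d)%N)
  (alpha : probability (borel_space R d) R) (fin3 : finite_moment 3 alpha)
  (disp : measure_display) (Omega : measurableType disp) (P : probability Omega R)
  (y : nat -> {RV P >-> borel_space R d}) (iid : iid_with_law y alpha)
  (n : nat) (n0 : (0 < n)%N).
Local Notation theta := (sqrt2 R).

(** 64 d comes from the smallest cells, 4 from the two tails of size 2 s / 4^L, with 4^(-L) <=
    2^(-L), and the second term from the block deviations. *)
Definition depth_cost (L : nat) : R := (64 * d%:R + 4) * (2 ^+ L)^-1 +
  8 * d%:R * 2 ^+ d * theta ^+ 3 *
    ((Num.sqrt n%:R)^-1 * \sum_(i < L.+1) (theta ^+ d / 2) ^+ i).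

Context (X : Omega -> \bar R) (kappa : R) (kappa0 : 0 <= kappa)
  (X0 : forall w, (0 <= X w)%E)
  (XW : forall w (m : probability (borel_space R d) R),
    (m : {measure set (borel_space R d) -> \bar R}) =
      empirical_measure (fun i => y i w) n -> (X w <= kappa%:E * W1 m alpha)%E).

Lemma expected_le_scale (s : R) (L : nat) : 0 < s -> moment 3 alpha <= s ->
  (\int[P]_w X w <= (kappa * (s * depth_cost L))%:E)%E.
Proof.
move=> s0 ms; have third := moment_integral3_le fin3 ms.
apply: (le_trans (expected_le_cells d0 iid n0 s0 kappa0 X0 XW (E := deviation_bound alpha s n)
  (fun t c => @integral_deviation_le R d alpha s L s0 n n0 disp Omega P y t c iid)
  (integral_tail_norm_le L s0 third))).
rewrite lee_fin ler_wpM2l//.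
have leaf := @sum_leaf_diam R d alpha s L s0 third.
have dev := @sum_block_diam_deviation R d alpha s L s0 third n n0.
apply: (le_trans (lerD (lerD leaf dev) (lexx _))).
rewrite /depth_cost.
have p1 : (2 ^+ L)^-1 <= 1 :> R by rewrite invf_le1 ?exprn_gt0// exprn_ege1// ler1n.
have p0 : 0 <= (2 ^+ L)^-1 :> R by rewrite invr_ge0 exprn_ge0.
move: ((2 ^+ L)^-1) p1 p0 (2 ^+ d) (theta ^+ 3) (\sum_(i < L.+1) _) => p p1 p0 e c S.
rewrite [leLHS](_ : _ = s * (64 * d%:R * p + 4 * (p * p) +
  8 * d%:R * e * c * ((Num.sqrt n%:R)^-1 * S))); last by ring.
by rewrite ler_pM2l// lerD2r [(64 * d%:R + 4) * p]mulrDl lerD2l ler_pM2l// ler_piMl.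
Qed.

Lemma expected_le_moment (L : nat) :
  (\int[P]_w X w <= (kappa * (moment 3 alpha * depth_cost L))%:E)%E.
Proof.
have m0 := moment_ge0 3 alpha.
have C0 : 0 <= kappa * depth_cost L.
  have t0 k : 0 <= theta ^+ k by rewrite exprn_ge0// ltW// sqrt2_gt0.
  have e0 k : 0 <= 2 ^+ k :> R by rewrite exprn_ge0.
  have S0 : 0 <= \sum_(i < L.+1) (theta ^+ d / 2) ^+ i.
    by apply: sumr_ge0 => i _; rewrite exprn_ge0// divr_ge0.
  have r0 : 0 <= (Num.sqrt n%:R)^-1 :> R by rewrite invr_ge0.
  apply: mulr_ge0 => //; apply: addr_ge0; last first.
    exact: mulr_ge0 (mulr_ge0 (mulr_ge0 (mulr_ge0 (ler0n _ 8) (ler0n _ d)) (e0 d)) (t0 3%N))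
      (mulr_ge0 r0 S0).
  by apply: mulr_ge0; rewrite ?invr_ge0// addr_ge0// mulr_ge0.
move: C0; set C := kappa * _ => C0.
have C1 : 0 < C + 1 by lra.
apply/lee_addgt0Pr => e e0.
(* The scale must be positive even if the moment is 0. The excess costs C e / (C + 1) <= e, and C +
   1 cannot vanish. *)
apply: (le_trans (@expected_le_scale (moment 3 alpha + e / (C + 1)) L _ _)).
- by rewrite ltr_wpDl// divr_gt0.
- by rewrite lerDl divr_ge0// ltW.
rewrite -EFinD lee_fin mulrCA [X in _ <= X + _]mulrCA mulrDl lerD2l -/C.
by rewrite mulrAC ler_pdivrMr// ler_pM2l//; lra.
Qed.

End expected_W1.

Theorem corollary2 (R : realType) (d : nat) (d_ge1 : (1 <= d)%N) :
  exists b : R, 0 < b /\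
  forall f : R -> R,
    admissible_profile d f ->
    derivable_halfline f ->
    (exists A1 : R, 0 < A1 /\
       forall r : R, 0 <= r -> r `^ (3 / 2) * `|f^`()%classic r| <= A1) ->
  forall A_f : R, 0 < A_f -> W1_stability_constant d f A_f ->
  forall sigma : R, 0 < sigma ->
  forall alpha : probability (borel_space R d) R, finite_moment 3 alpha ->
  forall (disp : measure_display) (Omega : measurableType disp)
    (P : probability Omega R) (y : nat -> {RV P >-> borel_space R d}),
    iid_with_law y alpha ->
  forall n : nat, (1 <= n)%N ->
    (\int[P]_w Sigma_sup_dist f
        (empirical_measure (fun i => y i w) n) alpha sigma
     <= (sigma * A_f * b / normalizer d f sigma * moment 3 alpha
           * rate R d n)%:E)%E.
Proof.
have [c [c0 cL]] := depth_rate R d_ge1.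
pose b1 : R := 64 * d%:R + 4.
pose b2 : R := 8 * d%:R * 2 ^+ d * sqrt2 R ^+ 3.
have b10 : 0 < b1 by rewrite ltr_wpDl// mulr_ge0.
have b20 : 0 <= b2.
  exact: mulr_ge0 (mulr_ge0 (mulr_ge0 (ler0n _ 8) (ler0n _ d)) (exprn_ge0 d (ler0n _ 2)))
    (exprn_ge0 3 (ltW (sqrt2_gt0 R))).
(* [b1] and [b2] are the coefficients of [depth_cost] and [c] comes from [depth_rate]; all depend on
   [d] only. *)
exists ((b1 + b2) * c); split; first by rewrite mulr_gt0// ltr_pwDl.
move=> f fadm _ _ A_f A0 stab sigma sigma0 alpha fin3 disp Omega P y iid n n0.
have N0 := normalizer_ge0 fadm sigma0.
have kappa0 : 0 <= sigma * A_f / normalizer d f sigma.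
  by rewrite divr_ge0// mulr_ge0// ltW.
have [L [L1 L2]] := cL n n0.
apply: (le_trans (expected_le_moment d_ge1 fin3 iid n0 kappa0 _ _ L)).
(* The supremum is nonnegative because its value at x = 0 is. *)
- move=> w; apply: (@le_trans _ _ (frobenius (Sigma f (empirical_measure (fun i => y i w) n) 0 sigma
    - Sigma f alpha 0 sigma))%:E); first by rewrite lee_fin sqrtr_ge0.
  by apply: ereal_sup_ubound; exists 0.
- move=> w m mE; rewrite -mE; apply: stab => //; last exact: finite_moment3_1.
  rewrite /finite_moment mE moment_integral1E integral_empirical_measure ?ltry//.
  + exact: measurable_frobenius.
  + by move=> x; exact: frobenius_ge0.
rewrite lee_fin.
have -> : sigma * A_f * ((b1 + b2) * c) / normalizer d f sigma * moment 3 alpha * rate R d n =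
    sigma * A_f / normalizer d f sigma * (moment 3 alpha * ((b1 + b2) * (c * rate R d n))) by ring.
rewrite ler_wpM2l// ler_wpM2l ?moment_ge0//.
have cr : c * plain_rate R d n <= c * rate R d n by rewrite ler_pM2l// plain_rate_le.
rewrite /depth_cost [leRHS]mulrDl; apply: lerD.
  by apply: ler_wpM2l; [exact: ltW|exact: le_trans cr].
by apply: ler_wpM2l => //; exact: le_trans cr.
Qed.
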